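(* Let $\mathbb{K}\in\{\mathbb{R},\mathbb{C}\}$ and let $\Omega\in\mathbb{K}^{n\times\ell}$ be any full-rank random embedding. For any problem dimension $d\in\mathbb{N}$ and any rank parameters $q,r\in\mathbb{N}$ with $q+\alpha_{\mathbb{K}}<\ell$ and $\ell\le r\le\min\{d,n\}$, $$\sup_{\substack{A\in\mathbb{K}^{d\times n}\\ \operatorname{rank}(A)=r}}\frac{\mathbb{E}\,\|A-\Pi_{A\Omega}A\|_{\rm F}^2}{\|A-[\![A]\!]_q\|_{\rm F}^2}\ \ge\ \frac{r-\ell}{r-q}\left(1+\frac{q}{\ell-q-\alpha_{\mathbb{K}}}\right).$$
   Context: $\mathbb{K}$ is the field of real or complex numbers, and $\alpha_{\mathbb{K}}=1$ if $\mathbb{K}=\mathbb{R}$, $\alpha_{\mathbb{K}}=0$ if $\mathbb{K}=\mathbb{C}$. $\|\cdot\|_{\rm F}$ is the Frobenius norm. All matrix dimensions are positive integers. An embedding is a matrix in $\mathbb{K}^{n\times\ell}$ with $n\ge\ell$; a random embedding is a random such matrix with an arbitrary distribution; it is full-rank if its rank is $\ell$ (with probability one). $\Pi_F$ denotes the orthogonal projection onto the range of a matrix $F$; $\Pi_{A\Omega}A$ is the randomized SVD approximation of $A$. $[\![A]\!]_q$ denotes an optimal rank-$q$ approximation of $A$, given by any $q$-truncated singular value decomposition. The matrices $A$ in the supremum are deterministic and the expectation is over $\Omega$. *)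

(* Defs.v *)
From mathcomp Require Import all_boot all_order all_algebra.
From mathcomp Require Import sesquilinear.
From mathcomp Require Import complex.
From mathcomp Require Import all_classical all_reals all_analysis.

Set Implicit Arguments.
Unset Strict Implicit.
Unset Printing Implicit Defensive.

Import Order.TTheory GRing.Theory Num.Theory.

Local Open Scope classical_set_scope.
Local Open Scope ring_scope.
Local Open Scope sesquilinear_scope.

Variant scalar_kind := RealScalars | ComplexScalars.

Definition alpha (k : scalar_kind) : nat :=
  match k with RealScalars => 1%N | ComplexScalars => 0%N end.

Definition scalar_field (R : realType) (k : scalar_kind) : numFieldType :=
  match k with
  | RealScalars => R
  | ComplexScalars => Num.NumField.clone R[i] _
  end.

Definition sconj (R : realType) (k : scalar_kind) :
    {rmorphism scalar_field R k -> scalar_field R k} :=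
  match k with
  | RealScalars => GRing.RMorphism.clone R R idfun _
  | ComplexScalars => GRing.RMorphism.clone R[i] R[i] (@conjc R) _
  end.

Definition sinj (R : realType) (k : scalar_kind) : {rmorphism R -> scalar_field R k} :=
  match k with
  | RealScalars => GRing.RMorphism.clone R R idfun _
  | ComplexScalars => GRing.RMorphism.clone R R[i] (real_complex R) _
  end.

(* The modulus as an element of R; the norm `|x| of R[i] has values in R[i]. *)
Definition sabs (R : realType) (k : scalar_kind) : scalar_field R k -> R :=
  match k with
  | RealScalars => fun x : R => `|x|
  | ComplexScalars => fun x : R[i] => ComplexField.Normc.normc x
  end.

(* The Borel sigma-algebra of the complex numbers is that of R x R. *)
Definition smeasurable_fun (R : realType) (k : scalar_kind)
    d (T : measurableType d) : (T -> scalar_field R k) -> Prop :=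
  match k with
  | RealScalars => fun X : T -> R => measurable_fun setT X
  | ComplexScalars => fun X : T -> R[i] =>
      measurable_fun setT (fun t => complex.Re (X t)) /\
      measurable_fun setT (fun t => complex.Im (X t))
  end.

Section Matrices.
Variables (R : realType) (k : scalar_kind).
Local Notation K := (scalar_field R k).

Definition frobenius m n (A : 'M[K]_(m, n)) : R :=
  Num.sqrt (\sum_(i < m) \sum_(j < n) sabs (A i j) ^+ 2).

(* MathComp subspaces are row spaces, so we transpose: <<F^T>> is the range of
   F and orthomx (sconj R k) 1%:M F^T its orthogonal complement in K^m. *)
Definition range_proj m n (F : 'M[K]_(m, n)) : 'M[K]_m :=
  (proj_mx <<F^T>>%MS (orthomx (sconj R k) 1%:M F^T))^T.

Definition unitary n (U : 'M[K]_n) : Prop := U *m U ^t (sconj R k) = 1%:M.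

(* Singular values are given by a sequence; only those of index below
   minn m n matter. *)
Definition diag_sv m n (s : nat -> R) : 'M[K]_(m, n) :=
  \matrix_(i < m, j < n) (if i == j :> nat then sinj R k (s i) else 0).

Definition is_svd m n (A : 'M[K]_(m, n))
    (U : 'M[K]_m) (s : nat -> R) (V : 'M[K]_n) : Prop :=
  [/\ unitary U, unitary V, (forall i, 0 <= s i),
      (forall i j, (i <= j)%N -> s j <= s i)
    & A = U *m diag_sv m n s *m V ^t (sconj R k)].

Definition is_truncated_svd q m n (A B : 'M[K]_(m, n)) : Prop :=
  exists U s V, is_svd A U s V /\
    B = U *m diag_sv m n (fun i => if (i < q)%N then s i else 0)
          *m V ^t (sconj R k).

(* A truncated SVD always exists but need not be unique: one is chosen. *)
Definition best_approx q m n (A : 'M[K]_(m, n)) : 'M[K]_(m, n) :=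
  xget 0 [set B | is_truncated_svd q A B].

Definition random_matrix d (T : measurableType d) m n
    (X : T -> 'M[K]_(m, n)) : Prop :=
  forall i j, smeasurable_fun (fun t => X t i j).

Definition full_rank_random_embedding d (T : measurableType d)
    (P : probability T R) n l (Omega : T -> 'M[K]_(n, l)) : Prop :=
  [/\ (l <= n)%N, random_matrix Omega
    & {ae P, forall t, \rank (Omega t) = l}].

End Matrices.

(* Main.v *)
Require Import Defs.
From mathcomp Require Import all_boot all_order all_algebra.
From mathcomp Require Import ring lra sesquilinear complex.
From mathcomp Require Import all_classical all_reals all_analysis.
From mathcomp Require Import measurable_realfun.

(* The supremum is bounded below along the matrices A = D Q V with D diagonal
   with singular values t (q times) and 1 (r - q times), V a fixed unitary matrix
   for which the first r rows of V Omega have rank l almost surely, and Q an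
   r x r unitary matrix. Writing M for these first r rows of V Omega, Y for the
   leading q x q block of the projection onto the range of Q M, and
   d = 1 / (t^2 - 1), the squared error is (1 + d) tr (Y + d)^-1 + r - q - l, while
   the best rank q approximation has squared error r - q.

   If Q were Haar distributed, the mean of tr Y^-1 would be
   q (r - q - alpha) / (l - q - alpha), by integration by parts for the function
   log det Y. Instead of integrating over the unitary group one uses a maximum
   principle: near a minimum over Q of the expectation of log det (Y + d), its
   second differences along plane rotations are almost nonnegative, and the sum of
   these second differences is, to leading order, proportional to
   (l - q - alpha) tr (Y + d)^-1 - (r - q - alpha) q + O(d tr (Y + d)^-2). The error
   term satisfies d tr (Y + d)^-2 <= 2 (tr (Y + d)^-1 - tr (Y + 2 d)^-1), which
   telescopes when log det (Y + d) is averaged over d in a geometric progression. *)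

Set Implicit Arguments.
Unset Strict Implicit.
Unset Printing Implicit Defensive.

Import Order.TTheory GRing.Theory Num.Theory.

Local Open Scope classical_set_scope.
Local Open Scope ring_scope.

(** * Scalars *)

Section Scalars.
Variables (R : realType) (k : scalar_kind).
Local Notation K := (scalar_field R k).
Local Notation cj := (sconj R k).
Local Notation inj := (sinj R k).

(** The block [Y] itself is never formed. The leading block of G = M (M^* (E + d) M)^-1 M^*, which
    is [wproj], equals Y (Y + d)^-1, and G depends only on the range of M. So M is never
    orthonormalized, and the entries of G are rational in those of M and their conjugates, hence
    measurable.

    The error term cannot be absorbed at a single d: if Y has an eigenvalue far below d, then d tr
    (Y + d)^-2 is comparable to tr (Y + d)^-1. Over N dyadic values of d its total stays below a
    multiple of a common bound S on the mean traces, whereas the main term is counted N times.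

    A near-minimum suffices because log det is bounded below for each fixed d. A tolerance of order
    s^3 is negligible against the s^2 of second differences along rotations of sine s, so neither
    compactness nor continuity enters.

    The number alpha comes from the phases that twist a rotation, 1 alone or 1 and i. The squares Re
    (w z)^2 add up to |z|^2 in both cases, while the remaining terms are multiplied by the number of
    phases, 2 - alpha. *)

Definition sre : K -> R :=
  match k return scalar_field R k -> R with
  | RealScalars => fun x : R => x
  | ComplexScalars => fun x : R[i] => complex.Re x
  end.

(* The units by which a plane rotation is twisted. *)
Definition phases : seq K :=
  match k return seq (scalar_field R k) with
  | RealScalars => [:: (1 : R)]
  | ComplexScalars => [:: (1 : R[i]); Complex 0 1]
  end.

Lemma sreD x y : sre (x + y) = sre x + sre y.
Proof. by rewrite /sre; case: k x y => //= -[a b] [c e]. Qed.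

Lemma sreN x : sre (- x) = - sre x.
Proof. by rewrite /sre; case: k x => //= -[a b]. Qed.

Lemma sreB x y : sre (x - y) = sre x - sre y.
Proof. by rewrite sreD sreN. Qed.

Lemma sre_inj x : sre (inj x) = x.
Proof. by rewrite /sre; case: k. Qed.

Lemma sre0 : sre 0 = 0.
Proof. by rewrite -(rmorph0 inj) sre_inj. Qed.

Lemma sre_sum I (s : seq I) (P : pred I) F :
  sre (\sum_(i <- s | P i) F i) = \sum_(i <- s | P i) sre (F i).
Proof. exact: (big_morph sre sreD sre0). Qed.

Lemma sreZ a x : sre (inj a * x) = a * sre x.
Proof. by rewrite /sre; case: k x => //= -[u v] /=; rewrite mul0r subr0. Qed.

Lemma sreC x : sre (cj x) = sre x.
Proof. by rewrite /sre; case: k x => //= -[u v]. Qed.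

Lemma sconjK x : cj (cj x) = x.
Proof. by case: k x => //= -[u v] /=; rewrite opprK. Qed.

Lemma sconj_inj a : cj (inj a) = inj a.
Proof. by case: k => //=; rewrite /real_complex_def oppr0. Qed.

Lemma sconj_real x : cj x = x -> x = inj (sre x).
Proof.
rewrite /sre; case: k x => //= -[u v] [] /eqP.
rewrite eq_sym -subr_eq0 opprK -mulr2n mulrn_eq0 /= => /eqP ->.
by [].
Qed.

Lemma mul_sconj x : x * cj x = inj (sabs x ^+ 2).
Proof.
case: k x => /= [x|]; first by rewrite real_normK ?num_real ?expr2.
by case=> u v /=; rewrite /ComplexField.Normc.normc sqr_sqrtr ?addr_ge0 ?sqr_ge0 //;
  apply/eqP; rewrite eq_complex /=; apply/andP; split; apply/eqP; ring.
Qed.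

Lemma sabs_ge0 (x : K) : 0 <= sabs x.
Proof. by case: k x => [x|[u v]] /=; rewrite ?sqrtr_ge0. Qed.

Lemma sabsM (x y : K) : sabs (x * y) = sabs x * sabs y.
Proof.
by case: k x y => [x y|x y] /=; rewrite ?normrM // ComplexField.Normc.normcM.
Qed.

Lemma sabs_inj a : sabs (inj a) = `|a|.
Proof. by case: k => //=; rewrite expr0n addr0 sqrtr_sqr. Qed.

Lemma sinj_eq0 a : (inj a == 0) = (a == 0).
Proof. exact: fmorph_eq0. Qed.

Lemma sinj_inj : injective inj.
Proof. exact: fmorph_inj. Qed.

Lemma sconj_eq0 x : (cj x == 0) = (x == 0).
Proof. exact: fmorph_eq0. Qed.

Lemma sabs_eq0 (x : K) : (sabs x == 0) = (x == 0).
Proof.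
by rewrite -sqrf_eq0 -sinj_eq0 -mul_sconj mulf_eq0 sconj_eq0 orbb.
Qed.

Lemma sabs0 : sabs (0 : K) = 0.
Proof. by apply/eqP; rewrite sabs_eq0. Qed.

Lemma sabsC x : sabs (cj x) = sabs x.
Proof.
by apply/eqP; rewrite -(eqrXn2 (n := 2)) ?sabs_ge0 //; apply/eqP/sinj_inj;
  rewrite -!mul_sconj sconjK mulrC.
Qed.

Lemma sre_sqr_le x : sre x ^+ 2 <= sabs x ^+ 2.
Proof.
rewrite /sre; case: k x => [x|[u v]] /=; first by rewrite real_normK ?num_real.
by rewrite sqr_sqrtr ?addr_ge0 ?sqr_ge0 // lerDl sqr_ge0.
Qed.

Lemma size_phases : ((size phases)%:R : R) = 2 - (alpha k)%:R.
Proof. by rewrite /phases; case: k => /=; lra. Qed.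

Lemma phases_unit w : w \in phases -> w * cj w = 1.
Proof.
rewrite /phases; case: k w => /= w; rewrite !inE; first by move=> /eqP ->; rewrite mulr1.
by case/orP => /eqP ->; apply/eqP; rewrite eq_complex /=;
  apply/andP; split; apply/eqP; ring.
Qed.

Lemma sum_phases x :
  \sum_(w <- phases) sre (w * x) ^+ 2 = sabs x ^+ 2.
Proof.
rewrite /sre /phases; case: k x => [x|[u v]] /=.
  by rewrite big_seq1 mul1r real_normK ?num_real.
rewrite !big_cons big_nil sqr_sqrtr ?addr_ge0 ?sqr_ge0 //=; ring.
Qed.

End Scalars.

(** * Conjugate transposes and weighted Gram matrices *)

Section Adjoint.
Variables (R : realType) (k : scalar_kind).
Local Notation K := (scalar_field R k).
Local Notation cj := (sconj R k).
Local Notation inj := (sinj R k).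

Definition ctr m n (A : 'M[K]_(m, n)) : 'M[K]_(n, m) := map_mx cj A^T.

Lemma ctrE m n (A : 'M[K]_(m, n)) i j : ctr A i j = cj (A j i).
Proof. by rewrite !mxE. Qed.

Lemma ctrK m n (A : 'M[K]_(m, n)) : ctr (ctr A) = A.
Proof. by apply/matrixP => i j; rewrite !ctrE sconjK. Qed.

Lemma ctrM m n p (A : 'M[K]_(m, n)) (B : 'M[K]_(n, p)) :
  ctr (A *m B) = ctr B *m ctr A.
Proof. by rewrite /ctr trmx_mul map_mxM. Qed.

Lemma ctrD m n (A B : 'M[K]_(m, n)) : ctr (A + B) = ctr A + ctr B.
Proof. by rewrite /ctr linearD map_mxD. Qed.

Lemma ctrN m n (A : 'M[K]_(m, n)) : ctr (- A) = - ctr A.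
Proof. by rewrite /ctr linearN map_mxN. Qed.

Lemma ctrB m n (A B : 'M[K]_(m, n)) : ctr (A - B) = ctr A - ctr B.
Proof. by rewrite ctrD ctrN. Qed.

Lemma ctrZ m n a (A : 'M[K]_(m, n)) : ctr (a *: A) = cj a *: ctr A.
Proof. by apply/matrixP => i j; rewrite !mxE rmorphM. Qed.


Lemma ctr1 n : ctr (1%:M : 'M[K]_n) = 1%:M.
Proof. by rewrite /ctr trmx1 map_mx1. Qed.

Lemma ctr_invmx n (A : 'M[K]_n) : ctr (invmx A) = invmx (ctr A).
Proof. by rewrite /ctr trmx_inv map_invmx. Qed.

Lemma ctr_diag n (a : 'I_n -> R) :
  ctr (diag_mx (\row_i inj (a i))) = diag_mx (\row_i inj (a i)).
Proof.
apply/matrixP => i j; rewrite ctrE !mxE eq_sym.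
by case: eqP => [->|_]; rewrite ?mulr1n ?mulr0n ?sconj_inj ?rmorph0.
Qed.

Lemma quad_diag m n (a : 'I_n -> R) (y : 'M[K]_(m, n)) i :
  (y *m diag_mx (\row_i inj (a i)) *m ctr y) i i =
  inj (\sum_j a j * sabs (y i j) ^+ 2).
Proof.
rewrite mul_mx_diag mxE raddf_sum; apply: eq_bigr => j _.
by rewrite ctrE !mxE mulrAC mul_sconj -rmorphM mulrC.
Qed.

Lemma quad_ctr m n (y : 'M[K]_(m, n)) i :
  (y *m ctr y) i i = inj (\sum_j sabs (y i j) ^+ 2).
Proof.
rewrite mxE raddf_sum; apply: eq_bigr => j _.
by rewrite ctrE mul_sconj.
Qed.

Lemma quad_ctr_eq0 n (y : 'rV[K]_n) : y *m ctr y = 0 -> y = 0.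
Proof.
move=> /matrixP /(_ 0 0); rewrite quad_ctr mxE => /eqP.
rewrite sinj_eq0 psumr_eq0 => [/allP y0|j _]; last exact: sqr_ge0.
apply/rowP => j; rewrite mxE; apply/eqP.
by rewrite -sabs_eq0 -sqrf_eq0; apply: y0; rewrite mem_index_enum.
Qed.

Lemma unitmx_inj n (A : 'M[K]_n) :
  (forall y : 'rV[K]_n, y *m A = 0 -> y = 0) -> A \in unitmx.
Proof.
move=> A_inj; rewrite -row_free_unit -kermx_eq0.
by apply/rowV0P => v /sub_kermxP /A_inj.
Qed.

(** Full column rank is expressed by a determinant polynomial in the entries and their conjugates;
    rank events become measurable in this form. *)
Lemma gram_unit m n (M : 'M[K]_(m, n)) :
  (ctr M *m M \in unitmx) = (\rank M == n).
Proof.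
apply/idP/eqP => [Gu|rM]; last first.
  apply: unitmx_inj => y yG; have yM : y *m ctr M = 0.
    apply: quad_ctr_eq0.
    by rewrite ctrM ctrK mulmxA -(mulmxA y) yG mul0mx.
  have Mf : row_free M^T by rewrite /row_free mxrank_tr rM.
  have yE : map_mx cj y *m M^T = 0.
    rewrite -(map_mx0 cj) -yM map_mxM; congr (_ *m _).
    by apply/matrixP => i j; rewrite !mxE sconjK.
  have /eqP : map_mx cj y = 0.
    by apply: (row_free_inj Mf); rewrite yE mul0mx.
  by rewrite map_mx_eq0 => /eqP.
apply/eqP; rewrite eqn_leq rank_leq_col /=.
by apply: leq_trans (mxrankM_maxr (ctr M) M); rewrite mxrank_unit.
Qed.

End Adjoint.

(** * The weighted analogue of the projection onto the range of M *)

Section Weighted.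
Variables (R : realType) (k : scalar_kind).
Local Notation K := (scalar_field R k).
Local Notation cj := (sconj R k).
Local Notation inj := (sinj R k).
Variables (r l : nat).

Definition wt (q : nat) (d : R) (i : 'I_r) : R := (i < q)%N%:R + d.

Lemma wt_gt0 q d i : 0 < d -> 0 < wt q d i.
Proof. by move=> d0; rewrite /wt ltr_wpDl. Qed.

Definition wmx q d : 'M[K]_r := diag_mx (\row_i inj (wt q d i)).

Definition wgram q d (M : 'M[K]_(r, l)) : 'M[K]_l := ctr M *m wmx q d *m M.

(* [M (M^* (E + d) M)^-1 M^*], with E the projection onto the first q
   coordinates. *)
Definition wproj q d (M : 'M[K]_(r, l)) : 'M[K]_r :=
  M *m invmx (wgram q d M) *m ctr M.

Variables (q : nat) (d : R) (M : 'M[K]_(r, l)).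
Hypothesis d_gt0 : 0 < d.
Hypothesis M_free : ctr M *m M \in unitmx.

Local Notation E := (wmx q d).
Local Notation W := (wgram q d M).
Local Notation G := (wproj q d M).

Lemma wgram_unit : W \in unitmx.
Proof.
apply: unitmx_inj => y yW.
have yM : y *m ctr M = 0.
  have : (y *m ctr M) *m E *m ctr (y *m ctr M) = 0.
    rewrite ctrM ctrK mulmxA -(mulmxA y) -(mulmxA y).
    by rewrite yW mul0mx.
  move=> /matrixP /(_ 0 0); rewrite quad_diag mxE => /eqP.
  rewrite sinj_eq0 psumr_eq0 => [/allP y0|j _]; last first.
    by rewrite mulr_ge0 ?sqr_ge0 // ltW // wt_gt0.
  apply/rowP => j; have := y0 j; rewrite mem_index_enum => /(_ isT).
  by rewrite mulf_eq0 gt_eqF ?wt_gt0 //= sqrf_eq0 sabs_eq0 => /eqP ->; rewrite mxE.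
have : y *m (ctr M *m M) = 0 by rewrite mulmxA yM mul0mx.
by move=> /(congr1 (mulmx^~ (invmx (ctr M *m M)))); rewrite mulmxK // mul0mx.
Qed.

Lemma ctr_wgram : ctr W = W.
Proof. by rewrite !ctrM ctrK ctr_diag mulmxA. Qed.

Lemma ctr_wproj : ctr G = G.
Proof. by rewrite !ctrM ctrK ctr_invmx ctr_wgram mulmxA. Qed.

(** Since G is self-adjoint, this writes G as G (E + d) G^*, so each diagonal entry is a weighted
    sum of squared moduli along its row. All positivity and size bounds on the entries rest on
    it. *)
Lemma wproj_idem : G *m E *m G = G.
Proof.
rewrite /wproj -!mulmxA; congr (_ *m _).
rewrite (mulmxA (ctr M)) (mulmxA (ctr M *m _)) mulmxA (mulmxA (_ *m _)).
by rewrite -/(wgram q d M) mulVmx ?wgram_unit // mul1mx.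
Qed.

Lemma wproj_diag i :
  G i i = inj (\sum_j wt q d j * sabs (G i j) ^+ 2).
Proof. by rewrite -quad_diag ctr_wproj wproj_idem. Qed.

Lemma wproj_conj i j : cj (G i j) = G j i.
Proof. by rewrite -ctrE ctr_wproj. Qed.

Definition dg i : R := sre (G i i).
Definition sq i j : R := sabs (G i j) ^+ 2.

Lemma dgE i : G i i = inj (dg i).
Proof. by rewrite /dg wproj_diag sre_inj. Qed.

Lemma dg_sum i : dg i = \sum_j wt q d j * sq i j.
Proof. by rewrite /dg wproj_diag sre_inj. Qed.

Lemma sq_ge0 i j : 0 <= sq i j. Proof. exact: sqr_ge0. Qed.

Lemma sqC i j : sq i j = sq j i.
Proof. by rewrite /sq -wproj_conj sabsC. Qed.

Lemma sq_dg i : sq i i = dg i ^+ 2.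
Proof. by rewrite /sq dgE sabs_inj real_normK ?num_real. Qed.

Lemma dg_ge0 i : 0 <= dg i.
Proof.
by rewrite dg_sum sumr_ge0 // => j _; rewrite mulr_ge0 ?sq_ge0 // ltW ?wt_gt0.
Qed.

Lemma wt_sq_le i j : wt q d j * sq i j <= dg i.
Proof.
rewrite dg_sum (bigD1 j) //= lerDl sumr_ge0 // => t _.
by rewrite mulr_ge0 ?sq_ge0 // ltW ?wt_gt0.
Qed.

Lemma wt_dg_le1 i : wt q d i * dg i <= 1.
Proof.
have := wt_sq_le i i; rewrite sq_dg expr2 mulrA => le1.
have := dg_ge0 i; rewrite le_eqVlt => /orP[/eqP <-|g0]; first by rewrite mulr0.
by rewrite -(ler_pM2r g0) mul1r.
Qed.

Lemma wproj_trace : \sum_i wt q d i * dg i = l%:R.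
Proof.
apply: (@sinj_inj R k); rewrite raddf_sum rmorph_nat.
have <- : \tr (G *m E) = l%:R.
  rewrite mxtrace_mulC /wproj mulmxA mxtrace_mulC 2!mulmxA.
  by rewrite -/(wgram q d M) mulmxV ?wgram_unit // mxtrace1.
rewrite /mxtrace; apply: eq_bigr => i _.
by rewrite mul_mx_diag mxE dgE mxE /= rmorphM mulrC.
Qed.

End Weighted.

(** * Trace identities and inequalities for the weighted projection *)

Lemma sqr_sum_le (R : realFieldType) (I : finType) (P : pred I) (x : I -> R) :
  (\sum_(i | P i) x i) ^+ 2 <= #|P|%:R * \sum_(i | P i) x i ^+ 2.
Proof.
have [P0|P0] := posnP #|P|.
  rewrite !big_pred0 ?mulr0 ?expr0n //= => i; exact: card0_eq.
have n0 : 0 < #|P|%:R :> R by rewrite ltr0n.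
pose s := \sum_(i | P i) x i; pose m := s / #|P|%:R.
have : 0 <= \sum_(i | P i) (x i - m) ^+ 2 by rewrite sumr_ge0 // => i _; rewrite sqr_ge0.
rewrite (eq_bigr (fun i => x i ^+ 2 + (- (2 * m) * x i + m ^+ 2))); last by move=> i _; ring.
have -> : \sum_(i | P i) (x i ^+ 2 + (- (2 * m) * x i + m ^+ 2)) =
    \sum_(i | P i) x i ^+ 2 + (- (2 * m) * s + #|P|%:R * m ^+ 2).
  by rewrite !big_split /= -mulr_sumr sumr_const -[m ^+ 2 *+ _]mulr_natl.
rewrite /m; set t := \sum_(i | P i) _; rewrite -(ler_pM2l n0) mulr0.
have -> : #|P|%:R * (t + (- (2 * (s / #|P|%:R)) * s + #|P|%:R * (s / #|P|%:R) ^+ 2)) =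
  #|P|%:R * t - s ^+ 2 by field; rewrite gt_eqF.
by rewrite subr_ge0.
Qed.

Section Traces.
Variables (R : realType) (k : scalar_kind).
Local Notation K := (scalar_field R k).
Local Notation inj := (sinj R k).
Variables (r l q : nat).
Hypothesis qr : (q <= r)%N.

Definition toptr d (M : 'M[K]_(r, l)) : R := \sum_(i < r | (i < q)%N) dg q d M i.

(* The trace of [(Y + d)^-1], where [Y] is the leading q x q block of the
   orthogonal projection onto the range of [M]. *)
Definition tau d (M : 'M[K]_(r, l)) : R := (q%:R - toptr d M) / d.

Variables (M : 'M[K]_(r, l)).
Hypothesis M_free : ctr M *m M \in unitmx.

Local Notation W := (fun d => wgram q d M).
Local Notation G := (fun d => wproj q d M).

Lemma wgramD d e : W (d + e) = W d + inj e *: (ctr M *m M).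
Proof.
have wD : wmx k r q (d + e) = wmx k r q d + (inj e)%:M.
  apply/matrixP => i j; rewrite !mxE /wt addrA !rmorphD.
  by case: eqP => _; rewrite ?mulr1n ?mulr0n ?addr0.
by rewrite /wgram wD mulmxDr mulmxDl mul_mx_scalar scalemxAl.
Qed.

(** Changing d adds a multiple of the Gram matrix to the weighted Gram matrix, so this is the usual
    resolvent identity multiplied by M on the left and M^* on the right. *)
Lemma resolvent d e : 0 < d -> 0 < e ->
  G d - G e = inj (e - d) *: (G d *m G e).
Proof.
move=> d0 e0; have := wgramD d (e - d); rewrite addrC subrK => WE.
have Wd : W d \in unitmx by rewrite wgram_unit.
have We : W e \in unitmx by rewrite wgram_unit.
transitivity (M *m (invmx (W d) *m (W e - W d) *m invmx (W e)) *m ctr M).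
  rewrite /wproj -mulmxBl -mulmxBr; congr (_ *m _ *m _).
  by rewrite mulmxBr mulVmx // mulmxBl mul1mx -mulmxA mulmxV // mulmx1.
have -> : W e - W d = inj (e - d) *: (ctr M *m M) by rewrite WE addrAC subrr add0r.
rewrite -scalemxAr -scalemxAl -scalemxAr -scalemxAl.
by rewrite /wproj !mulmxA.
Qed.

Variable d : R.
Hypothesis d0 : 0 < d.

Local Notation a := (toptr d M).
Local Notation b := (\sum_(i < r | (i < q)%N) \sum_(j < r | (j < q)%N) sq q d M i j).
Local Notation c := (\sum_(i < r | (i < q)%N) \sum_(j < r | ~~ (j < q)%N) sq q d M i j).
Local Notation g := (\sum_(j < r | ~~ (j < q)%N) dg q d M j).

Lemma wtT (i : 'I_r) : (i < q)%N -> wt q d i = 1 + d.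
Proof. by rewrite /wt => ->. Qed.

Lemma wtF (i : 'I_r) : ~~ (i < q)%N -> wt q d i = d.
Proof. by rewrite /wt => /negbTE ->; rewrite add0r. Qed.

Lemma toptr_split : a = (1 + d) * b + d * c.
Proof.
rewrite !mulr_sumr -big_split /=; apply: eq_bigr => i _.
rewrite dg_sum // (bigID (fun j : 'I_r => (j < q)%N)) /= !mulr_sumr.
by congr (_ + _); apply: eq_bigr => j jq; [rewrite wtT|rewrite wtF].
Qed.

Lemma trace_split : (1 + d) * a + d * g = l%:R.
Proof.
rewrite -(wproj_trace q d0 M_free) [RHS](bigID (fun j : 'I_r => (j < q)%N)) /= !mulr_sumr.
by congr (_ + _); apply: eq_bigr => j jq; [rewrite wtT|rewrite wtF].
Qed.

Lemma card_top : #|[pred i : 'I_r | (i < q)%N]| = q.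
Proof.
rewrite -sum1_card -[RHS](card_ord q) -sum1_card (big_ord_widen r (fun=> 1%N) qr).
by apply: eq_bigl => i; rewrite inE.
Qed.

Lemma card_bot : #|[pred i : 'I_r | ~~ (i < q)%N]| = (r - q)%N.
Proof.
apply: (@addnI q); rewrite subnKC // -[RHS](card_ord r).
by rewrite -(cardC [pred i : 'I_r | (i < q)%N]) card_top.
Qed.

Lemma natr_top : q%:R = \sum_(i < r | (i < q)%N) 1 :> R.
Proof. by rewrite -[in LHS]card_top -sum1_card natr_sum. Qed.

Lemma natr_bot : (r - q)%N%:R = \sum_(i < r | ~~ (i < q)%N) 1 :> R.
Proof. by rewrite -[in LHS]card_bot -sum1_card natr_sum. Qed.

Lemma toptr_ge0 : 0 <= a.
Proof. by rewrite sumr_ge0 // => i _; rewrite dg_ge0. Qed.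

Lemma dg_top_le1 (i : 'I_r) : (i < q)%N -> dg q d M i <= 1.
Proof.
move=> iq; have := wt_dg_le1 q d0 M_free i; rewrite wtT // => le1.
have := dg_ge0 q d0 M_free i => ge0.
have : 0 <= d * dg q d M i by rewrite mulr_ge0 // ltW.
lra.
Qed.

Lemma toptr_le : a <= q%:R.
Proof.
rewrite [leRHS]natr_top ler_sum // => i; exact: dg_top_le1.
Qed.

Lemma tau_ge0 : 0 <= tau d M.
Proof. by rewrite divr_ge0 ?(ltW d0) // subr_ge0 toptr_le. Qed.

Lemma tau_le : tau d M <= q%:R / d.
Proof. by rewrite ler_pM2r ?invr_gt0 // lerBlDr lerDl toptr_ge0. Qed.

(** This is (tr X)^2 <= q tr X^2 for the q x q block X = d (Y + d)^-1, the identity minus the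
    leading block of G. *)
Lemma toptr_cauchy : (q%:R - a) ^+ 2 <= q%:R * (q%:R - 2 * a + b).
Proof.
have -> : q%:R - a = \sum_(i < r | (i < q)%N) (1 - dg q d M i).
  by rewrite sumrB -natr_top.
have := sqr_sum_le [pred i : 'I_r | (i < q)%N] (fun i => 1 - dg q d M i).
move/le_trans; apply; rewrite card_top ler_wpM2l //.
rewrite (eq_bigr (fun i => (1 - 2 * dg q d M i) + dg q d M i ^+ 2)); last by move=> i _; ring.
rewrite big_split /= sumrB -mulr_sumr -natr_top.
rewrite lerD2l ler_sum // => i iq.
by rewrite (bigD1 i) //= sq_dg // lerDl sumr_ge0 // => j _; rewrite sq_ge0.
Qed.

(** On an eigenvalue y of Y the claim reads (y / (y + d))^2 <= y / (y + 2 d). In matrix form, G(2d)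
    - G(d) E G(d) = d^2 G(d) G(2d) G(d), with E the projection onto the first q coordinates; the
    right side is positive semidefinite. *)
Lemma sum_sq_le_toptr : b <= toptr (2 * d) M.
Proof.
have d2 : 0 < 2 * d by rewrite mulr_gt0.
rewrite -subr_ge0 -sumrB sumr_ge0 // => i iq.
have R1 := resolvent d0 d2; have R2 := resolvent d2 d0.
have A1 := ctr_wproj q d M; have A2 := ctr_wproj q (2 * d) M.
have I1 := wproj_idem q d0 M_free; have I2 := wproj_idem q d2 M_free.
rewrite /dg /sq.
move: (wproj q d M) (wproj q (2 * d) M) R1 R2 A1 A2 I1 I2 => X Y.
rewrite (_ : 2 * d - d = d); last by ring.
rewrite (_ : d - 2 * d = - d); last by ring.
rewrite rmorphN scaleNr => R1 R2 A1 A2 I1 I2.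
have {}R2 : X - Y = inj d *: (Y *m X) by rewrite -[LHS]opprB R2 opprK.
have idem : X *m wmx k r q 0 *m X = X - inj d *: (X *m X).
  rewrite -[X in _ = X - _]I1.
  rewrite scalemxAl -mulmxBl; congr (_ *m _); rewrite -mul_mx_scalar -mulmxBr.
  congr (_ *m _); apply/matrixP => u v; rewrite !mxE /wt addr0 rmorphD.
  by case: eqP => _; rewrite ?mulr1n ?mulr0n ?addrK ?subr0.
have E1 : Y - X *m wmx k r q 0 *m X = inj (d ^+ 2) *: (X *m Y *m X).
  rewrite idem opprB addrCA -[Y - _]opprB R1 -scalerBr -mulmxBr R2.
  by rewrite -scalemxAr scalerA -rmorphM mulmxA expr2.
have /(congr1 (fun A : 'M[K]_r => sre (A i i))) := E1.
have subE (A B : 'M[K]_r) : (A - B) i i = A i i - B i i by rewrite !mxE.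
rewrite subE sreB -[X in _ *m X]A1 quad_diag sre_inj.
have -> : \sum_j wt q 0 j * sabs (X i j) ^+ 2 = \sum_(j < r | (j < q)%N) sabs (X i j) ^+ 2.
  rewrite [RHS]big_mkcond /=; apply: eq_bigr => j _; rewrite /wt addr0.
  by case: ifP => _; rewrite ?mul1r ?mul0r.
move=> ->; rewrite mxE sreZ mulr_ge0 ?sqr_ge0 //.
have <- : X *m Y *m wmx k r q (2 * d) *m ctr (X *m Y) = X *m Y *m X.
  by rewrite ctrM A1 A2 !mulmxA -2!(mulmxA X) I2.
rewrite quad_diag sre_inj sumr_ge0 // => j _.
by rewrite mulr_ge0 ?sqr_ge0 // ltW // wt_gt0.
Qed.

(** Put t = [tau d M] and t2 = [tau (2 * d) M]. The trace identities make the left side equal to (l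
    - q - alpha) t - (r - q - alpha) q + (1 + d) (d t^2 + alpha y) + (r - 2 q - 2 alpha) d t, where
    y = d tr (Y + d)^-2. Then d t^2 <= q y and d <= 1 bound the third term by (2 q + 2) y, and y <=
    2 (t - t2) yields the constant 4 q + 4. *)
Lemma drift_le : d <= 1 ->
  \sum_(i < r | (i < q)%N) \sum_(j < r | ~~ (j < q)%N)
     (dg q d M j - dg q d M i - dg q d M i * dg q d M j
       - (alpha k)%:R * sq q d M i j) <=
  (l%:R - q%:R - (alpha k)%:R) * tau d M - ((r - q)%N%:R - (alpha k)%:R) * q%:R
  + (4 * q%:R + 4) * (tau d M - tau (2 * d) M) + (r - q)%N%:R * d * tau d M.
Proof.
move=> d1.
have -> : \sum_(i < r | (i < q)%N) \sum_(j < r | ~~ (j < q)%N)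
     (dg q d M j - dg q d M i - dg q d M i * dg q d M j
       - (alpha k)%:R * sq q d M i j) =
  (q%:R - a) * g - (r - q)%N%:R * a - (alpha k)%:R * c.
  rewrite [in (q%:R - a) * g]natr_top -sumrB mulr_suml.
  rewrite !mulr_sumr -!sumrB; apply: eq_bigr => i _.
  rewrite !mulr_sumr natr_bot mulr_suml -!sumrB.
  by apply: eq_bigr => j _; ring.
have := toptr_split; have := trace_split; have := toptr_cauchy.
have := sum_sq_le_toptr; have := toptr_ge0; have := toptr_le.
rewrite /tau; set a2 := toptr (2 * d) M.
set A := toptr d M; set B := b; set C := c; set g' := g; set p := (r - q)%N%:R.
move=> Aq A0 Ba2 cau tr sp.
have B0 : 0 <= B by rewrite !sumr_ge0 // => i _; rewrite sumr_ge0 // => j _; rewrite sq_ge0.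
have p0 : 0 <= p :> R by [].
have al : 0 <= ((alpha k)%:R : R) <= 1 by case: (k); rewrite /= ?lexx ler01.
set al' := (alpha k)%:R in al *.
clearbody A B C g' a2 p al'.
set t := (q%:R - A) / d; set t2 := (q%:R - a2) / (2 * d).
have AE : A = q%:R - d * t by rewrite /t; field; rewrite gt_eqF.
have a2E : a2 = q%:R - 2 * d * t2 by rewrite /t2; field; rewrite gt_eqF.
have t0 : 0 <= t by rewrite /t divr_ge0 ?(ltW d0) // subr_ge0.
have dn : d != 0 by rewrite gt_eqF.
have gE : g' = (l%:R - (1 + d) * A) / d by rewrite -tr; field.
(* [y = d tr Z^2], where [Z = (Y + d)^-1]. *)
pose y := (q%:R - 2 * A + B) / d.
have CE : C = t + 2 * d * t - q%:R - (1 + d) * y.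
  apply: (mulfI dn); rewrite (_ : d * C = A - (1 + d) * B); last by rewrite sp; ring.
  by rewrite /y /t; field.
have y_le : y <= 2 * (t - t2).
  rewrite /y ler_pdivrMr //; rewrite a2E in Ba2; rewrite AE; lra.
have y_ge : d * t ^+ 2 <= q%:R * y.
  rewrite /y mulrA ler_pdivlMr // (_ : d * t ^+ 2 * d = (q%:R - A) ^+ 2) //.
  by rewrite AE; ring.
have y0 : 0 <= y.
  rewrite /y divr_ge0 ?(ltW d0) //.
  have [q0|q0] := posnP q; first by rewrite q0 in Aq *; lra.
  have q0' : 0 < q%:R :> R by rewrite ltr0n.
  by rewrite -(pmulr_rge0 _ q0') (le_trans _ cau) ?sqr_ge0.
have -> : (q%:R - A) * g' = t * (l%:R - (1 + d) * A) by rewrite gE /t; field.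
rewrite CE AE.
have dt2 : 0 <= d * t ^+ 2 by rewrite mulr_ge0 ?sqr_ge0 ?(ltW d0).
have dq : 0 <= d * q%:R * t by exact: mulr_ge0 (mulr_ge0 (ltW d0) (ler0n _ _)) t0.
have e1 : d * (d * t ^+ 2) <= d * t ^+ 2 by rewrite ler_piMl.
have e2 : al' * y <= y by case/andP: al => _; apply: ler_piMl.
have e3 : d * (al' * y) <= al' * y.
  by case/andP: al => al0 _; apply: ler_piMl d1; exact: mulr_ge0.
have e4 : 0 <= al' * d * t.
  by case/andP: al => al0 _; exact: mulr_ge0 (mulr_ge0 al0 (ltW d0)) t0.
have e5 : (4 * q%:R + 4) * y <= (4 * q%:R + 4) * (2 * (t - t2)).
  by apply: ler_wpM2l y_le; rewrite addr_ge0 ?mulr_ge0 ?ler0n.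
clearbody t t2 y; lra.
Qed.
End Traces.

(** * Determinants under low-rank updates and reflections *)

Lemma det_add1_mulC (F : comNzRingType) m n (A : 'M[F]_(m, n)) (B : 'M[F]_(n, m)) :
  \det (1%:M + A *m B) = \det (1%:M + B *m A).
Proof.
pose T := block_mx 1%:M A (- B) 1%:M.
have T1 : T = block_mx 1%:M 0 (- B) 1%:M *m block_mx 1%:M A 0 (1%:M + B *m A).
  by rewrite mulmx_block !(mul1mx, mulmx1, mul0mx, mulmx0, addr0) mulNmx addrCA addNr addr0.
have T2 : T = block_mx (1%:M + A *m B) A 0 1%:M *m block_mx 1%:M 0 (- B) 1%:M.
  by rewrite mulmx_block !(mul1mx, mulmx1, mul0mx, mulmx0, add0r) mulmxN addrK.
have := T1; rewrite T2 => /(congr1 determinant).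
by rewrite !det_mulmx !det_lblock !det_ublock !det1 !mul1r !mulr1.
Qed.

Lemma det_add_mul (F : fieldType) m n (W : 'M[F]_m) (A : 'M[F]_(m, n)) (B : 'M[F]_(n, m)) :
  W \in unitmx ->
  \det (W + A *m B) = \det (1%:M + B *m invmx W *m A) * \det W.
Proof.
move=> Wu; rewrite -mulmxA -det_add1_mulC [RHS]mulrC -det_mulmx mulmxDr mulmx1.
by rewrite !mulmxA mulmxV // mul1mx.
Qed.

Section Det.
Variables (R : realType) (k : scalar_kind).
Local Notation K := (scalar_field R k).
Local Notation cj := (sconj R k).
Local Notation inj := (sinj R k).

Lemma det_block11 (a b c d : 'M[K]_1) :
  \det (block_mx a b c d) = a 0 0 * d 0 0 - b 0 0 * c 0 0.
Proof.
rewrite (expand_det_row _ (lshift 1 0)) big_split_ord !big_ord1.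
rewrite block_mxEul block_mxEur /cofactor !det_mx11.
have e1 : lift (lshift 1 (0 : 'I_1)) 0 = rshift 1 0 by exact: val_inj.
have e2 : lift (rshift 1 (0 : 'I_1)) 0 = lshift 1 0 by exact: val_inj.
have rcE i j (A : 'M[K]_(1 + 1)) : row' i (col' j A) 0 0 = A (lift i 0) (lift j 0).
  by rewrite !mxE.
rewrite !rcE e1 e2 block_mxEdl block_mxEdr.
by rewrite expr0 expr1 mul1r mulN1r mulrN.
Qed.

(** The Householder reflection when w has norm one. Reflections stand in for plane rotations because
    they are self-adjoint involutions; the two differ only by the sign of a row that does not enter
    the leading block. *)
Definition refl n (w : 'rV[K]_n) : 'M[K]_n := 1%:M - 2 *: (ctr w *m w).

Lemma ctr_refl n (w : 'rV[K]_n) : ctr (refl w) = refl w.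
Proof. by rewrite ctrB ctr1 ctrZ ctrM ctrK rmorph_nat. Qed.

Lemma refl_sq n (w : 'rV[K]_n) : w *m ctr w = 1%:M -> refl w *m refl w = 1%:M.
Proof.
move=> w1; rewrite /refl mulmxBl mul1mx -scalemxAl mulmxBr mulmx1.
rewrite -scalemxAr -mulmxA (mulmxA w) w1 mul1mx.
by apply/matrixP => i j; rewrite !mxE; ring.
Qed.

Lemma row_refl n m (w : 'rV[K]_n) (M : 'M[K]_(n, m)) i :
  row i (refl w *m M) = row i M - (2 * cj (w 0 i)) *: (w *m M).
Proof.
rewrite /refl mulmxBl mul1mx -scalemxAl -mulmxA; move: (w *m M) => v.
by apply/rowP => j; rewrite !mxE big_ord1 !mxE mulrA.
Qed.

Lemma wgram_rows r l q d (M : 'M[K]_(r, l)) :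
  wgram q d M = inj d *: (ctr M *m M) +
     \sum_(i < r | (i < q)%N) ctr (row i M) *m row i M.
Proof.
apply/matrixP => u v; rewrite /wgram mul_mx_diag !mxE summxE mulr_sumr.
rewrite [X in _ + X]big_mkcond -big_split /=; apply: eq_bigr => i _.
rewrite !mxE big_ord1 !mxE /wt rmorphD mulrDr mulrDl addrC; congr (_ + _).
  by case: (i < q)%N; rewrite ?rmorph1 ?rmorph0 ?mulr1 ?mulr0 ?mul0r.
by ring.
Qed.

(* Row [i] becomes [(1 - 2 p^2) row i - 2 p y w row j]; row [j] changes as well,
   but only the first [q] rows enter [wgram q d]. *)
Lemma det_wgram_refl r l q d (M : 'M[K]_(r, l)) (i j : 'I_r) (p y : R) (w : K) :
  0 < d -> ctr M *m M \in unitmx -> (i < q)%N -> ~~ (j < q)%N ->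
  p ^+ 2 + y ^+ 2 = 1 -> w * cj w = 1 ->
  let v := inj p *: delta_mx 0 i + (inj y * w) *: delta_mx 0 j : 'rV[K]_r in
  let c := 1 - 2 * p ^+ 2 in let s := 2 * p * y in
  [/\ refl v *m refl v = 1%:M &
   \det (wgram q d (refl v *m M)) = inj (1 + s ^+ 2 * (dg q d M j - dg q d M i -
      dg q d M i * dg q d M j + sq q d M i j)
      - 2 * c * s * sre (w * wproj q d M j i)) * \det (wgram q d M)].
Proof.
move=> d0 Mf iq jq py w1 v c s.
have ij : i != j by apply: contraNneq jq => <-.
have vi : v 0 i = inj p by rewrite !mxE !eqxx (negbTE ij) mulr1 mulr0 addr0.
have vj : v 0 j = inj y * w by rewrite !mxE !eqxx [j == i]eq_sym (negbTE ij) mulr0 mulr1 add0r.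
have v0 t : t != i -> t != j -> v 0 t = 0.
  by move=> ti tj; rewrite !mxE (negbTE ti) (negbTE tj) !mulr0 addr0.
have vM : v *m M = inj p *: row i M + (inj y * w) *: row j M.
  by rewrite mulmxDl -!scalemxAl -!rowE.
have v1 : v *m ctr v = 1%:M.
  apply/matrixP => a b; rewrite !ord1 quad_ctr mxE mulr1n.
  rewrite (bigD1 i) //= (bigD1 j) 1?eq_sym //= vi vj big1 => [|t /andP[ti tj]]; last first.
    by rewrite v0 // sabs0 expr0n.
  have sw : sabs w ^+ 2 = 1 by apply: (@sinj_inj R k); rewrite -mul_sconj w1 rmorph1.
  by rewrite sabsM exprMn sw !sabs_inj !real_normK ?num_real // mulr1 addr0 py rmorph1.
split; first exact: refl_sq.
pose a := row i M; pose b := row j M.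
pose x := inj c *: a - (inj s * w) *: b.
have rx : row i (refl v *m M) = x.
  rewrite row_refl vi vM sconj_inj /x /c /s -/a -/b.
  rewrite !(rmorphB, rmorphM, rmorphXn, rmorph1, rmorph_nat).
  by apply/rowP => t; rewrite !mxE; ring.
have G1 : ctr (refl v *m M) *m (refl v *m M) = ctr M *m M.
  by rewrite ctrM ctr_refl mulmxA -(mulmxA _ _ (refl v)) refl_sq // mulmx1.
(* The Gram matrix is unchanged and only row i among the first q rows moves, so the update has rank
   two: the old row is removed and x is added. The determinant lemma then leaves a 2 x 2
   determinant. *)
have W' : wgram q d (refl v *m M) = wgram q d M +
    row_mx (- ctr a) (ctr x) *m col_mx a x.
  rewrite mul_row_col !wgram_rows G1 -addrA; congr (_ + _).
  rewrite (bigD1 i) //= [in RHS](bigD1 i) //= rx mulNmx -/a.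
  rewrite [RHS]addrACA subrr add0r addrC; congr (_ + _).
  apply: eq_bigr => t /andP[tq ti].
  have tj : t != j by apply: contraNneq jq => <-.
  by rewrite row_refl v0 // rmorph0 mulr0 scale0r subr0.
have Wu : wgram q d M \in unitmx by exact: wgram_unit.
have GE e f : row e M *m invmx (wgram q d M) *m ctr (row f M) = (wproj q d M e f)%:M.
  rewrite [LHS]mx11_scalar; congr _%:M; rewrite /wproj /ctr tr_row map_col -!row_mul.
  by rewrite !colE mulmxA -colE [LHS]mxE [LHS]mxE.
rewrite W' det_add_mul //; congr (_ * _).
rewrite mul_col_mx mul_col_row [1%:M](@scalar_mx_block _ 1 1) add_block_mx det_block11.
have xW : x *m invmx (wgram q d M) = inj c *: (a *m invmx (wgram q d M)) -
    (inj s * w) *: (b *m invmx (wgram q d M)) by rewrite mulmxBl -!scalemxAl.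
have xc : ctr x = inj c *: ctr a - (inj s * cj w) *: ctr b.
  by rewrite ctrB !ctrZ rmorphM !sconj_inj.
rewrite xW xc !mulmxN !mulmxBl !mulmxBr -!scalemxAl -!scalemxAr !GE.
rewrite -(wproj_conj q d M j i) (dgE q d0 Mf i) (dgE q d0 Mf j).
have sqE : wproj q d M j i * cj (wproj q d M j i) = inj (sq q d M i j).
  by rewrite mul_sconj sqC.
move: (wproj q d M j i) sqE => z sqE.
move: (dg q d M i) (dg q d M j) (sq q d M i j) sqE => al ga be sqE.
have reE : w * z + cj w * cj z = inj (2 * sre (w * z)).
  rewrite -rmorphM; move: (w * z) => t.
  rewrite (sconj_real (x := t + cj t)); first by rewrite sreD sreC mulr2n mulrDl !mul1r.
  by rewrite rmorphD sconjK addrC.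
(* If p and y are the sine and cosine of an angle, c and s are the cosine and sine of its double. *)
have cs : inj c ^+ 2 + inj s ^+ 2 - 1 = 0.
  apply/eqP; rewrite -!rmorphXn -rmorphD -(rmorph1 inj) -rmorphB sinj_eq0.
  rewrite (_ : _ - 1 = 4 * p ^+ 2 * (p ^+ 2 + y ^+ 2 - 1)); last by rewrite /c /s; ring.
  by rewrite py subrr mulr0.
have -> : inj (1 + s ^+ 2 * (ga - al - al * ga + be) - 2 * c * s * sre (w * z)) =
  1 + inj s ^+ 2 * (inj ga - inj al - inj al * inj ga + inj be) -
  inj c * inj s * (w * z + cj w * cj z).
  rewrite reE -!rmorphM -!rmorphB -!rmorphD -rmorphXn -rmorphM -(rmorph1 inj).
  by rewrite -rmorphD -rmorphB; congr (inj _); ring.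
clear rx W' x xW xc; clearbody c s.
have DE (A B : 'M[K]_1) : (A + B) 0 0 = A 0 0 + B 0 0 by rewrite mxE.
have NE (A : 'M[K]_1) : (- A) 0 0 = - A 0 0 by rewrite mxE.
have ZE e (A : 'M[K]_1) : (e *: A) 0 0 = e * A 0 0 by rewrite mxE.
have SE (e : K) : (e%:M : 'M[K]_1) 0 0 = e by rewrite mxE mulr1n.
have OE : (0 : 'M[K]_1) 0 0 = 0 by rewrite mxE.
rewrite !(DE, NE, ZE, SE, OE).
move: (inj c) (inj s) (inj al) (inj ga) (inj be) (cj w) (cj z) cs w1 sqE =>
  C S AL GA BE CW CZ cs w1 <-.
apply/eqP; rewrite -subr_eq0; apply/eqP.
transitivity ((C ^+ 2 + S ^+ 2 - 1) * AL
  + S ^+ 2 * (w * CW - 1) * (GA * (1 - AL) + z * CZ)); first by ring.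
by rewrite cs w1 subrr mulr0 !mul0r addr0.
Qed.

(** Raising q by one is a rank-one update by a new row. It multiplies the determinant by 1 + g,
    where g is a diagonal entry of [wproj] at an index of weight d and so lies between 0 and 1 /
    d. *)
Lemma det_wgram_bounds r l q d (M : 'M[K]_(r, l)) :
  (q <= r)%N -> 0 < d -> ctr M *m M \in unitmx ->
  exists2 w : R, \det (wgram q d M) = inj w * \det (ctr M *m M) &
    d ^+ l <= w <= d ^+ l * (1 + d^-1) ^+ q.
Proof.
move=> + d0 Mf; elim: q => [_|q IH qr].
  exists (d ^+ l); last by rewrite expr0 mulr1 lexx.
  by rewrite wgram_rows big_pred0 ?addr0 ?detZ ?rmorphXn.
have [w wE /andP[w1 w2]] := IH (ltnW qr).
pose i := Ordinal qr.
have WE : wgram q.+1 d M = wgram q d M + ctr (row i M) *m row i M.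
  rewrite !wgram_rows -addrA; congr (_ + _); rewrite (bigD1 i) //= addrC.
  congr (_ + _); apply: eq_bigl => j; rewrite ltnS leq_eqVlt andb_orl.
  by rewrite -(inj_eq val_inj) /=; case: ltngtP.
have GE : row i M *m invmx (wgram q d M) *m ctr (row i M) = (wproj q d M i i)%:M.
  rewrite [LHS]mx11_scalar; congr _%:M; rewrite /wproj /ctr tr_row map_col -!row_mul.
  by rewrite !colE mulmxA -colE [LHS]mxE [LHS]mxE.
have g0 := dg_ge0 q d0 Mf i.
have g1 : dg q d M i <= d^-1.
  by have := wt_dg_le1 q d0 Mf i; rewrite wtF ?ltnn // -[d^-1]mulr1 ler_pdivlMl.
exists (w * (1 + dg q d M i)).
  rewrite WE det_add_mul ?wgram_unit // GE (dgE q d0 Mf) wE.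
  have DE : (1%:M + (inj (dg q d M i))%:M : 'M[K]_1) 0 0 = 1 + inj (dg q d M i).
    by rewrite !mxE !mulr1n.
  by rewrite det_mx11 DE [in RHS]rmorphM [in RHS]rmorphD rmorph1 mulrA [inj w * _]mulrC.
have w0 : 0 <= w by rewrite (le_trans _ w1) // exprn_ge0 // ltW.
apply/andP; split; first by rewrite (le_trans w1) // ler_peMr // lerDl.
by rewrite exprSr mulrA ler_pM // ?addr_ge0 // lerD2l.
Qed.

End Det.

(** * Second differences of log det *)

Section Increment.
Variables (R : realType) (k : scalar_kind) (r l q : nat).
Hypothesis qr : (q <= r)%N.
Local Notation K := (scalar_field R k).
Local Notation cj := (sconj R k).
Local Notation inj := (sinj R k).
Local Notation al := ((alpha k)%:R : R).

(** Dividing by the Gram determinant leaves a function of the range of M: it is log det (Y + d) up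
    to the additive constant (l - q) ln d. *)
Definition logdet d (M : 'M[K]_(r, l)) : R :=
  ln (sabs (\det (wgram q d M) / \det (ctr M *m M))).

Definition prefl (i j : 'I_r) (w : K) (p y : R) : 'M[K]_r :=
  refl (inj p *: delta_mx 0 i + (inj y * w) *: delta_mx 0 j).

(** The upper bound of [drift_le] rather than the exact sum, since it is affine in [tau] and its
    mean involves only means of [tau]. *)
Definition drift d (M : 'M[K]_(r, l)) : R :=
  (l%:R - q%:R - al) * tau q d M - ((r - q)%N%:R - al) * q%:R
  + (4 * q%:R + 4) * (tau q d M - tau q (2 * d) M) + (r - q)%N%:R * d * tau q d M.

(** For i < q <= j one has G_ii <= 1, while G_jj and |G_ij|^2 are at most 1 / d. Hence 1 + 2 / d
    bounds the absolute value of the coefficient of s^2 in the determinant ratio, and 4 / d bounds 4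
    |G_ij|^2. *)
Definition rem_cst (d : R) : R := (1 + 2 / d) ^+ 2 + 4 / d.

Definition sum_rem (d : R) : R :=
  \sum_(i < r | (i < q)%N) \sum_(j < r | ~~ (j < q)%N) \sum_(w <- phases R k) rem_cst d.

Variables (M : 'M[K]_(r, l)) (d : R).
Hypothesis M_free : ctr M *m M \in unitmx.
Hypothesis d0 : 0 < d.

Lemma logdet_bounds :
  ln (d ^+ l) <= logdet d M <= ln (d ^+ l * (1 + d^-1) ^+ q).
Proof.
have [w wE /andP[w1 w2]] := det_wgram_bounds qr d0 M_free.
have dl : 0 < d ^+ l by rewrite exprn_gt0.
have w0 : 0 < w by exact: lt_le_trans w1.
rewrite /logdet wE mulfK -?unitfE -?unitmxE // sabs_inj gtr0_norm //.
by rewrite !ler_ln ?posrE ?w1 ?w2 // mulr_gt0 // exprn_gt0 // addr_gt0 // invr_gt0.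
Qed.

Lemma rem_cst_ge0 : 0 <= rem_cst d.
Proof. by rewrite addr_ge0 ?sqr_ge0 // divr_ge0 // ltW. Qed.

(** Positivity of D is not visible in its explicit formula; it comes from the lower bounds on both
    normalized determinants. *)
Lemma logdet_ratio N D : ctr N *m N = ctr M *m M ->
  \det (wgram q d N) = inj D * \det (wgram q d M) ->
  0 < D /\ logdet d N = ln D + logdet d M.
Proof.
move=> NM DE; have N_free : ctr N *m N \in unitmx by rewrite NM.
have [w wE /andP[w1 _]] := det_wgram_bounds qr d0 M_free.
have [v vE /andP[v1 _]] := det_wgram_bounds qr d0 N_free.
have dl : 0 < d ^+ l by rewrite exprn_gt0.
have w0 : 0 < w by exact: lt_le_trans w1.
have v0 : 0 < v by exact: lt_le_trans v1.
have detM : \det (ctr M *m M) != 0 by rewrite -unitfE -unitmxE.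
have vD : v = D * w.
  apply: (@sinj_inj R k); rewrite rmorphM; apply: (mulIf detM).
  by rewrite -mulrA -wE -DE vE NM.
have D0 : 0 < D by rewrite -(pmulr_lgt0 _ w0) -vD.
split=> //; rewrite /logdet vE NM wE !mulfK // !sabs_inj !gtr0_norm //.
by rewrite vD lnM ?posrE.
Qed.

Lemma rem_cst_bound (i j : 'I_r) : (i < q)%N -> ~~ (j < q)%N ->
  (dg q d M j - dg q d M i - dg q d M i * dg q d M j + sq q d M i j) ^+ 2
    + 4 * sq q d M i j <= rem_cst d.
Proof.
move=> iq jq.
have di0 := dg_ge0 q d0 M_free i; have dj0 := dg_ge0 q d0 M_free j.
have di1 := dg_top_le1 M_free d0 iq.
have dj1 : dg q d M j <= d^-1.
  by have := wt_dg_le1 q d0 M_free j; rewrite wtF // -[d^-1]mulr1 ler_pdivlMl.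
have s0 := sq_ge0 q d M i j.
have s1 : sq q d M i j <= d^-1.
  have := wt_sq_le q d0 M_free i j; rewrite wtF // -[d^-1]mulr1 ler_pdivlMl //.
  by move=> /le_trans; apply.
have dV : 0 < d^-1 by rewrite invr_gt0.
rewrite /rem_cst; move: (dg q d M i) (dg q d M j) (sq q d M i j) di0 dj0 di1 dj1 s0 s1.
move: d^-1 dV => e e0 x y z x0 y0 x1 y1 z0 z1.
apply: lerD; last by rewrite ler_pM2l.
have xy0 : 0 <= x * y by exact: mulr_ge0.
have xy1 : x * y <= e by rewrite -[e]mul1r ler_pM.
rewrite -[leLHS]real_normK ?num_real // ler_sqr ?nnegrE //; last by lra.
by rewrite ler_norml; apply/andP; split; lra.
Qed.

(** Replacing y by -y reverses s and keeps c. The two determinant ratios x1 and x2 thus differ in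
    the sign of their first-order term, which cancels to first order in x1 x2. The bound follows
    from ln x1 + ln x2 <= x1 x2 - 1 and c^2 = 1 - s^2. *)
Lemma logdet_incr (i j : 'I_r) w p y : (i < q)%N -> ~~ (j < q)%N ->
  p ^+ 2 + y ^+ 2 = 1 -> w * cj w = 1 ->
  logdet d (prefl i j w p y *m M) + logdet d (prefl i j w p (- y) *m M)
    - 2 * logdet d M <=
  (2 * p * y) ^+ 2 * (2 * (dg q d M j - dg q d M i - dg q d M i * dg q d M j + sq q d M i j)
     - 4 * sre (w * wproj q d M j i) ^+ 2) + (2 * p * y) ^+ 4 * rem_cst d.
Proof.
move=> iq jq py w1.
have pyN : p ^+ 2 + (- y) ^+ 2 = 1 by rewrite sqrrN.
have [u1 e1] := det_wgram_refl d0 M_free iq jq py w1.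
have [u2 e2] := det_wgram_refl d0 M_free iq jq pyN w1.
have gramE (v : 'rV[K]_r) : refl v *m refl v = 1%:M ->
    ctr (refl v *m M) *m (refl v *m M) = ctr M *m M.
  by move=> v1; rewrite ctrM ctr_refl mulmxA -(mulmxA (ctr M)) v1 mulmx1.
have [D1 E1] := logdet_ratio (gramE _ u1) e1.
have [D2 E2] := logdet_ratio (gramE _ u2) e2.
rewrite /prefl E1 E2 {E1 E2 e1 e2 u1 u2 gramE}.
have := rem_cst_bound iq jq.
have rs : sre (w * wproj q d M j i) ^+ 2 <= sq q d M i j.
  rewrite (le_trans (sre_sqr_le _)) // sabsM exprMn sqC.
  rewrite (_ : sabs w ^+ 2 = 1) ?mul1r //.
  by apply: (@sinj_inj R k); rewrite -mul_sconj w1 rmorph1.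
move: D1 D2 rs; rewrite /sq.
move: (sre (w * wproj q d M j i)) (sabs (wproj q d M i j) ^+ 2) => rho be.
set kap := dg q d M j - dg q d M i - dg q d M i * dg q d M j + be.
clearbody kap; move: (logdet d M) (rem_cst d) => L C D1 D2 rs kC.
set x1 := 1 + _ - _ in D1 *; set x2 := 1 + _ - _ in D2 *.
have lnle : ln x1 + ln x2 <= x1 * x2 - 1.
  rewrite -lnM ?posrE // -[X in ln X](subrK 1) addrC le_ln1Dx //.
  by rewrite ltrBrDl subrr mulr_gt0.
have LE u v : u + L + (v + L) - 2 * L = u + v by ring.
rewrite LE; apply: (le_trans lnle).
have s4 : 0 <= (2 * p * y) ^+ 4 by rewrite -[4%N]/(2 * 2)%N exprM sqr_ge0.
have -> : x1 * x2 - 1 = (2 * p * y) ^+ 2 * (2 * kap - 4 * rho ^+ 2)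
    + (2 * p * y) ^+ 4 * (kap ^+ 2 + 4 * rho ^+ 2).
  have yE : y ^+ 2 = 1 - p ^+ 2 by rewrite -py addrAC subrr add0r.
  rewrite /x1 /x2.
  transitivity (2 * (4 * p ^+ 2 * y ^+ 2) * kap + (4 * p ^+ 2 * y ^+ 2) ^+ 2 * kap ^+ 2
     - 4 * (1 - 2 * p ^+ 2) ^+ 2 * (4 * p ^+ 2 * y ^+ 2) * rho ^+ 2); first by ring.
  transitivity ((4 * p ^+ 2 * y ^+ 2) * (2 * kap - 4 * rho ^+ 2)
     + (4 * p ^+ 2 * y ^+ 2) ^+ 2 * (kap ^+ 2 + 4 * rho ^+ 2)); last by ring.
  by rewrite yE; ring.
rewrite lerD2l ler_wpM2l // (le_trans _ kC) // lerD2l ler_pM2l //.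
Qed.

(** For fixed i and j put x = G_jj - G_ii - G_ii G_jj and b = |G_ij|^2. Summing 2 (x + b) - 4 Re (w
    G_ji)^2 over the 2 - alpha phases gives 2 (2 - alpha) (x - alpha b), because alpha^2 = alpha;
    this is the summand of [drift_le]. *)
Lemma sum_logdet_incr p y : d <= 1 -> p ^+ 2 + y ^+ 2 = 1 ->
  \sum_(i < r | (i < q)%N) \sum_(j < r | ~~ (j < q)%N) \sum_(w <- phases R k)
    (logdet d (prefl i j w p y *m M) + logdet d (prefl i j w p (- y) *m M)
      - 2 * logdet d M) <=
  2 * (2 - al) * (2 * p * y) ^+ 2 * drift d M + (2 * p * y) ^+ 4 * sum_rem d.
Proof.
move=> d1 py; have := drift_le qr M_free d0 d1; rewrite -/(drift d M).
set s := 2 * p * y; set X := \sum_(i < r | _) _ => Xd.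
have al2 : 0 <= 2 * (2 - al) * s ^+ 2.
  by rewrite mulr_ge0 ?sqr_ge0 // mulr_ge0 // -size_phases.
apply: le_trans (_ : 2 * (2 - al) * s ^+ 2 * X + s ^+ 4 * sum_rem d <= _); last first.
  by rewrite lerD2r ler_wpM2l.
rewrite /X /sum_rem !mulr_sumr -big_split; apply: ler_sum => i iq /=.
rewrite !mulr_sumr -big_split; apply: ler_sum => j jq /=.
rewrite big_seq; apply: le_trans (ler_sum _ (fun w wp => logdet_incr iq jq py (phases_unit wp))) _.
rewrite -big_seq big_split /= lerD2r.
rewrite -mulr_sumr sumrB -[X in _ - X]mulr_sumr sum_phases sqC big_const_seq count_predT.
rewrite iter_addr_0. rewrite -[_ *+ size _]mulr_natr size_phases /sq -/s.
have aa : al * al = al by case: (k); rewrite /= ?mulr1 ?mulr0.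
rewrite le_eqVlt; apply/orP; left; apply/eqP.
move: (sabs _ ^+ 2) => b; move: (dg q d M i) (dg q d M j) => x z.
transitivity (s ^+ 2 * (2 * (2 - al) * (z - x - x * z)) + s ^+ 2 * (- 2 * al) * b); first by ring.
transitivity (s ^+ 2 * (2 * (2 - al) * (z - x - x * z)) +
  s ^+ 2 * (- 2 * (2 * al - al * al)) * b); last by ring.
by rewrite aa; ring.
Qed.

End Increment.

(** * Measurability *)

Section Measurability.
Variables (R : realType) (k : scalar_kind).
Local Notation K := (scalar_field R k).
Local Notation cj := (sconj R k).
Local Notation inj := (sinj R k).
Variables (disp : measure_display) (T : measurableType disp).
Local Notation sM := (@smeasurable_fun R k disp T).

Lemma smeas_cst (x : K) : sM (fun=> x).
Proof. by case: k x => x /=; [exact: measurable_cst|split; exact: measurable_cst]. Qed.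

Lemma smeasD (X Y : T -> K) : sM X -> sM Y -> sM (fun t => X t + Y t).
Proof.
case: k X Y => X Y /=; first exact: measurable_funD.
move=> [X1 X2] [Y1 Y2]; split.
  by rewrite (_ : (fun t => _) = (fun t => complex.Re (X t) + complex.Re (Y t)));
    [exact: measurable_funD|apply/funext => t; rewrite raddfD].
by rewrite (_ : (fun t => _) = (fun t => complex.Im (X t) + complex.Im (Y t)));
    [exact: measurable_funD|apply/funext => t; rewrite raddfD].
Qed.

Lemma smeasM (X Y : T -> K) : sM X -> sM Y -> sM (fun t => X t * Y t).
Proof.
case: k X Y => X Y /=; first exact: measurable_funM.
move=> [X1 X2] [Y1 Y2]; split.
  rewrite (_ : (fun t => _) = (fun t => complex.Re (X t) * complex.Re (Y t) -
     complex.Im (X t) * complex.Im (Y t))).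
    by apply: measurable_funB; exact: measurable_funM.
  by apply/funext => t; case: (X t) (Y t) => a b [c e].
rewrite (_ : (fun t => _) = (fun t => complex.Re (X t) * complex.Im (Y t) +
     complex.Im (X t) * complex.Re (Y t))).
  by apply: measurable_funD; exact: measurable_funM.
by apply/funext => t; case: (X t) (Y t) => a b [c e].
Qed.

Lemma smeasC (X : T -> K) : sM X -> sM (fun t => cj (X t)).
Proof.
case: k X => X //= [X1 X2]; split.
  by rewrite (_ : (fun t => _) = (fun t => complex.Re (X t))) //;
    apply/funext => t; case: (X t).
rewrite (_ : (fun t => _) = \- (fun t => complex.Im (X t))); first exact: measurable_funN.
by apply/funext => t /=; case: (X t).
Qed.

Lemma smeas_inj (X : T -> R) : measurable_fun setT X -> sM (fun t => inj (X t)).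
Proof. by case: k => //= mX; split => //; exact: measurable_cst. Qed.

Lemma measurable_sre (X : T -> K) : sM X -> measurable_fun setT (fun t => sre (X t)).
Proof. by rewrite /sre; case: k X => X //= -[]. Qed.

Lemma measurable_sabs2 (X : T -> K) : sM X -> measurable_fun setT (fun t => sabs (X t) ^+ 2).
Proof.
move=> mX; rewrite (_ : (fun t => _) = (fun t => sre (X t * cj (X t)))).
  by apply/measurable_sre/smeasM => //; exact: smeasC.
by apply/funext => t; rewrite mul_sconj sre_inj.
Qed.

Lemma measurable_pos_inv (f : T -> R) : (forall t, 0 < f t) ->
  measurable_fun setT f -> measurable_fun setT (fun t => (f t)^-1).
Proof.
move=> f0 mf; rewrite (_ : (fun t => _) = (fun t => expR (- ln (f t)))).
  apply: (measurableT_comp (@measurable_expR R)).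
  by apply: measurable_funN; exact: (measurableT_comp (@measurable_ln R)).
by apply/funext => t; rewrite expRN lnK ?posrE.
Qed.

Lemma smeasV (X : T -> K) : (forall t, X t != 0) -> sM X -> sM (fun t => (X t)^-1).
Proof.
move=> X0 mX; rewrite (_ : (fun t => _) = (fun t => cj (X t) * inj ((sabs (X t) ^+ 2)^-1))).
  apply: smeasM; first exact: smeasC.
  apply: smeas_inj; apply: measurable_pos_inv; last exact: measurable_sabs2.
  by move=> t; rewrite exprn_gt0 // lt_def sabs_eq0 X0 sabs_ge0.
apply/funext => t; rewrite fmorphV -mul_sconj invfM mulrCA mulfV ?mulr1 //.
by rewrite sconj_eq0.
Qed.

Lemma smeas_sum I (s : seq I) (P : pred I) (X : I -> T -> K) :
  (forall i, sM (X i)) -> sM (fun t => \sum_(i <- s | P i) X i t).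
Proof.
move=> mX; elim: s => [|i s IH].
  by rewrite (_ : (fun t => _) = (fun=> 0)); [exact: smeas_cst|apply/funext => t; rewrite big_nil].
case Pi: (P i); last first.
  by rewrite (_ : (fun t => _) = (fun t => \sum_(i <- s | P i) X i t)) //;
    apply/funext => t; rewrite big_cons Pi.
rewrite (_ : (fun t => _) = (fun t => X i t + \sum_(i <- s | P i) X i t)).
  exact: smeasD.
by apply/funext => t; rewrite big_cons Pi.
Qed.

Lemma smeas_prod I (s : seq I) (P : pred I) (X : I -> T -> K) :
  (forall i, sM (X i)) -> sM (fun t => \prod_(i <- s | P i) X i t).
Proof.
move=> mX; elim: s => [|i s IH].
  by rewrite (_ : (fun t => _) = (fun=> 1)); [exact: smeas_cst|apply/funext => t; rewrite big_nil].
case Pi: (P i); last first.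
  by rewrite (_ : (fun t => _) = (fun t => \prod_(i <- s | P i) X i t)) //;
    apply/funext => t; rewrite big_cons Pi.
rewrite (_ : (fun t => _) = (fun t => X i t * \prod_(i <- s | P i) X i t)).
  exact: smeasM.
by apply/funext => t; rewrite big_cons Pi.
Qed.

Lemma rmx_cst m n (A : 'M[K]_(m, n)) : random_matrix (fun _ : T => A).
Proof. by move=> i j; exact: smeas_cst. Qed.

Lemma rmxM m n p (X : T -> 'M[K]_(m, n)) (Y : T -> 'M[K]_(n, p)) :
  random_matrix X -> random_matrix Y -> random_matrix (fun t => X t *m Y t).
Proof.
move=> mX mY i j.
rewrite (_ : (fun t => _) = (fun t => \sum_u X t i u * Y t u j)).
  by apply: smeas_sum => u; exact: smeasM.
by apply/funext => t; rewrite mxE.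
Qed.

Lemma rmxC m n (X : T -> 'M[K]_(m, n)) :
  random_matrix X -> random_matrix (fun t => ctr (X t)).
Proof.
move=> mX i j; rewrite (_ : (fun t => _) = (fun t => cj (X t j i))); first exact: smeasC.
by apply/funext => t; rewrite ctrE.
Qed.

Lemma smeas_det n (X : T -> 'M[K]_n) : random_matrix X -> sM (fun t => \det (X t)).
Proof.
move=> mX; rewrite /determinant; apply: smeas_sum => s.
by apply: smeasM; [exact: smeas_cst|exact: smeas_prod].
Qed.

Lemma rmxV n (X : T -> 'M[K]_n) : (forall t, X t \in unitmx) ->
  random_matrix X -> random_matrix (fun t => invmx (X t)).
Proof.
move=> Xu mX i j.
rewrite (_ : (fun t => _) = (fun t => (\det (X t))^-1 *
    ((-1) ^+ (j + i) * \det (row' j (col' i (X t)))))).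
  apply: smeasM.
    by apply: smeasV; [move=> t; rewrite -unitfE -unitmxE|exact: smeas_det].
  apply: smeasM; first exact: smeas_cst.
  apply: smeas_det => u v; rewrite (_ : (fun t => _) = (fun t => X t (lift j u) (lift i v))) //.
  by apply/funext => t; rewrite !mxE.
by apply/funext => t; rewrite /invmx Xu !mxE.
Qed.

Lemma measurable_gram_unit m n (X : T -> 'M[K]_(m, n)) : random_matrix X ->
  measurable [set t | ctr (X t) *m X t \in unitmx].
Proof.
move=> mX; pose f t := sabs (\det (ctr (X t) *m X t)) ^+ 2.
have mf : measurable_fun setT f.
  by apply/measurable_sabs2/smeas_det/rmxM => //; exact: rmxC.
rewrite (_ : [set t | _] = f @^-1` [set~ 0]).
  by rewrite -[X in measurable X]setTI; apply: mf => //; apply: measurableC.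
apply/seteqP; split => t /=; rewrite unitmxE unitfE /f => /eqP.
  by move=> d0; apply/eqP; rewrite sqrf_eq0 sabs_eq0; apply/eqP.
by rewrite sqrf_eq0 sabs_eq0.
Qed.

Section Fields.
Variables (r l q : nat) (d : R) (M : T -> 'M[K]_(r, l)).
Hypothesis d0 : 0 < d.
Hypothesis mM : random_matrix M.
Hypothesis M_free : forall t, ctr (M t) *m M t \in unitmx.

Lemma measurable_tau : measurable_fun setT (fun t => tau q d (M t)).
Proof.
apply: measurable_funM; last exact: measurable_cst.
apply: measurable_funB; first exact: measurable_cst.
rewrite (_ : (fun t => _) = (fun t => sre (\sum_(i < r | (i < q)%N) wproj q d (M t) i i))).
  apply/measurable_sre/smeas_sum => i.
  apply: (rmxM (rmxM mM _) (rmxC mM)); apply: rmxV => [t|]; first exact: wgram_unit.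
  by apply: rmxM => //; apply: rmxM; [exact: rmxC|exact: rmx_cst].
by apply/funext => t; rewrite sre_sum.
Qed.

Lemma measurable_logdet : measurable_fun setT (fun t => logdet q d (M t)).
Proof.
have mG : random_matrix (fun t => ctr (M t) *m M t) by apply: rmxM => //; exact: rmxC.
(* The squared modulus, unlike the modulus, is polynomial in the real and imaginary parts; hence
   half the logarithm of the square. *)
rewrite (_ : (fun t => _) = (fun t => 2^-1 *
    ln (sabs (\det (wgram q d (M t)) / \det (ctr (M t) *m M t)) ^+ 2))).
  apply: measurable_funM; first exact: measurable_cst.
  apply: (measurableT_comp (@measurable_ln R)); apply: measurable_sabs2.
  apply: smeasM.
    by apply/smeas_det/rmxM => //; apply: rmxM; [exact: rmxC|exact: rmx_cst].
  by apply: smeasV; [move=> t; rewrite -unitfE -unitmxE|exact: smeas_det].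
apply/funext => t; rewrite lnXn; last first.
  rewrite lt_def sabs_eq0 sabs_ge0 andbT mulf_neq0 ?invr_eq0 //.
    by rewrite -unitfE -unitmxE wgram_unit.
  by rewrite -unitfE -unitmxE.
by rewrite /logdet; move: (ln _) => L; rewrite -(mulr_natl L 2) mulKf.
Qed.

End Fields.
End Measurability.

(** * The maximum principle *)

Section BoundedMeasurable.
Variables (R : realType) (disp : measure_display) (T : measurableType disp).
Variable P : probability T R.

Definition bmeas (f : T -> R) : Prop :=
  measurable_fun setT f /\ exists C, forall t, `|f t| <= C.

Lemma bmeas_integrable f : bmeas f -> P.-integrable setT (EFin \o f).
Proof.
move=> [mf [C fC]]; apply: measurable_bounded_integrable => //.
  by apply: le_lt_trans (probability_le1 P measurableT) _; rewrite ltry.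
exists C; split; first exact: num_real.
by move=> y Cy t _ /=; rewrite (le_trans (fC t)) // ltW.
Qed.

Lemma bmeas_cst c : bmeas (fun=> c).
Proof. by split; [exact: measurable_cst|exists `|c|]. Qed.

Lemma bmeasD f g : bmeas f -> bmeas g -> bmeas (fun t => f t + g t).
Proof.
move=> [mf [C fC]] [mg [D gD]]; split; first exact: measurable_funD.
by exists (C + D) => t; rewrite (le_trans (ler_normD _ _)) // lerD.
Qed.

Lemma bmeasZ c f : bmeas f -> bmeas (fun t => c * f t).
Proof.
move=> [mf [C fC]]; split; first by apply: measurable_funM => //; exact: measurable_cst.
by exists (`|c| * C) => t; rewrite normrM ler_wpM2l.
Qed.

Lemma bmeasB f g : bmeas f -> bmeas g -> bmeas (fun t => f t - g t).
Proof.
move=> bf bg; rewrite (_ : (fun t => _) = (fun t => f t + (-1) * g t)).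
  by apply: bmeasD => //; exact: bmeasZ.
by apply/funext => t; rewrite mulN1r.
Qed.

Lemma bmeas_sum I (s : seq I) (Q : pred I) (f : I -> T -> R) :
  (forall i, Q i -> bmeas (f i)) -> bmeas (fun t => \sum_(i <- s | Q i) f i t).
Proof.
move=> bf; elim: s => [|i s IH].
  by rewrite (_ : (fun t => _) = (fun=> 0)); [exact: bmeas_cst|apply/funext => t; rewrite big_nil].
case Qi: (Q i); last first.
  by rewrite (_ : (fun t => _) = (fun t => \sum_(i <- s | Q i) f i t)) //;
    apply/funext => t; rewrite big_cons Qi.
rewrite (_ : (fun t => _) = (fun t => f i t + \sum_(i <- s | Q i) f i t)).
  by apply: bmeasD => //; exact: bf.
by apply/funext => t; rewrite big_cons Qi.
Qed.

Definition mean (f : T -> R) : R := Rintegral P setT f.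

Lemma mean_cst c : mean (fun=> c) = c.
Proof.
have PT : fine (P setT) = 1 by rewrite probability_setT.
rewrite /mean Rintegral_cst // -[RHS]mulr1; congr (_ * _).
exact: PT.
Qed.

Lemma meanD f g : bmeas f -> bmeas g -> mean (fun t => f t + g t) = mean f + mean g.
Proof. by move=> bf bg; apply: RintegralD => //; exact: bmeas_integrable. Qed.

Lemma meanB f g : bmeas f -> bmeas g -> mean (fun t => f t - g t) = mean f - mean g.
Proof. by move=> bf bg; apply: RintegralB => //; exact: bmeas_integrable. Qed.

Lemma meanZ c f : bmeas f -> mean (fun t => c * f t) = c * mean f.
Proof. by move=> bf; apply: RintegralZl => //; exact: bmeas_integrable. Qed.

Lemma mean_le f g : bmeas f -> bmeas g -> (forall t, f t <= g t) -> mean f <= mean g.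
Proof. by move=> bf bg fg; apply: le_Rintegral => //; exact: bmeas_integrable. Qed.

Lemma mean_sum I (s : seq I) (Q : pred I) (f : I -> T -> R) :
  (forall i, Q i -> bmeas (f i)) ->
  mean (fun t => \sum_(i <- s | Q i) f i t) = \sum_(i <- s | Q i) mean (f i).
Proof.
move=> bf; elim: s => [|i s IH].
  rewrite big_nil (_ : (fun t => _) = (fun=> 0)) ?mean_cst //.
  by apply/funext => t; rewrite big_nil.
rewrite big_cons -IH; case: ifP => Qi.
  rewrite -meanD; [|exact: bf|exact: bmeas_sum].
  by congr mean; apply/funext => t; rewrite big_cons Qi.
by congr mean; apply/funext => t; rewrite big_cons Qi.
Qed.

Lemma mean_second_diff f g h : bmeas f -> bmeas g -> bmeas h ->
  mean (fun t => f t + g t - 2 * h t) = mean f + mean g - 2 * mean h.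
Proof.
move=> bf bg bh; rewrite -(meanZ 2 bh) -(meanD bf bg).
exact: meanB (bmeasD bf bg) (bmeasZ 2 bh).
Qed.

Lemma bmeas_sum_seq (W : eqType) (s : seq W) (f : W -> T -> R) :
  {in s, forall w, bmeas (f w)} -> bmeas (fun t => \sum_(w <- s) f w t).
Proof.
move=> bf; rewrite (_ : (fun t => _) = (fun t => \sum_(w <- s | w \in s) f w t)).
  exact: bmeas_sum.
by apply/funext => t; rewrite -big_seq.
Qed.

Lemma mean_sum3 (I J W : eqType) (u : seq I) (v : seq J) (s : seq W)
    (Q1 : pred I) (Q2 : pred J) (f : I -> J -> W -> T -> R) :
  (forall i j w, Q1 i -> Q2 j -> w \in s -> bmeas (f i j w)) ->
  mean (fun t => \sum_(i <- u | Q1 i) \sum_(j <- v | Q2 j) \sum_(w <- s) f i j w t) =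
  \sum_(i <- u | Q1 i) \sum_(j <- v | Q2 j) \sum_(w <- s) mean (f i j w).
Proof.
move=> bf.
have b1 i j : Q1 i -> Q2 j -> bmeas (fun t => \sum_(w <- s) f i j w t).
  by move=> Qi Qj; apply: bmeas_sum_seq => w ws; exact: bf.
rewrite mean_sum => [|i Qi]; last by apply: bmeas_sum => j Qj; exact: b1.
apply: eq_bigr => i Qi; rewrite mean_sum => [|j Qj]; last exact: b1.
apply: eq_bigr => j Qj.
rewrite (_ : (fun t => _) = (fun t => \sum_(w <- s | w \in s) f i j w t)).
  by rewrite mean_sum => [|w ws]; [rewrite -big_seq|exact: bf].
by apply/funext => t; rewrite -big_seq.
Qed.

End BoundedMeasurable.

(** * Rotating a near-minimizer and averaging over dyadic values of d *)

Section Core.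
Variables (R : realType) (k : scalar_kind).
Local Notation K := (scalar_field R k).
Local Notation al := ((alpha k)%:R : R).
Variables (disp : measure_display) (T : measurableType disp).
Variable P : probability T R.
Variables (r l q : nat) (M : T -> 'M[K]_(r, l)).
Hypothesis qr : (q <= r)%N.
Hypothesis qal : (q + alpha k <= l)%N.
Hypothesis mM : random_matrix M.
Hypothesis M_free : forall t, ctr (M t) *m M t \in unitmx.

Lemma gram_unitary (V : 'M[K]_r) (X : 'M[K]_(r, l)) :
  ctr V *m V = 1%:M -> ctr (V *m X) *m (V *m X) = ctr X *m X.
Proof. by move=> V1; rewrite ctrM mulmxA -(mulmxA (ctr X)) V1 mulmx1. Qed.

Lemma bmeas_tau (V : 'M[K]_r) d : ctr V *m V = 1%:M -> 0 < d ->
  bmeas (fun t => tau q d (V *m M t)).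
Proof.
move=> V1 d0; split.
  apply: measurable_tau => // [|t]; last by rewrite gram_unitary.
  by apply: rmxM => //; exact: rmx_cst.
exists (q%:R / d) => t; rewrite ger0_norm; first by apply: tau_le => //; rewrite gram_unitary.
by apply: tau_ge0 => //; rewrite gram_unitary.
Qed.

Lemma bmeas_logdet (V : 'M[K]_r) d : ctr V *m V = 1%:M -> 0 < d ->
  bmeas (fun t => logdet q d (V *m M t)).
Proof.
move=> V1 d0; split.
  apply: measurable_logdet => // [|t]; last by rewrite gram_unitary.
  by apply: rmxM => //; exact: rmx_cst.
exists (`|ln (d ^+ l)| + `|ln (d ^+ l * (1 + d^-1) ^+ q)|) => t.
have := logdet_bounds qr (M := V *m M t) _ d0; rewrite gram_unitary // => /(_ (M_free t)).
move: (logdet _ _ _) (ln _) (ln _) => x b a /andP[ax xb].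
have := ler_norm b; have := ler_norm (- a); rewrite normrN => na nb.
have a0 := normr_ge0 a; have b0 := normr_ge0 b.
by rewrite ler_norml; apply/andP; split; lra.
Qed.

Lemma bmeas_drift (V : 'M[K]_r) d : ctr V *m V = 1%:M -> 0 < d ->
  bmeas (fun t => drift q d (V *m M t)).
Proof.
move=> V1 d0; rewrite /drift.
have d2 : 0 < 2 * d by rewrite mulr_gt0.
have b1 := bmeas_tau V1 d0; have b2 := bmeas_tau V1 d2.
apply: bmeasD; last exact: bmeasZ.
apply: bmeasD; last by apply/bmeasZ/bmeasB.
by apply: bmeasB; [exact: bmeasZ|exact: bmeas_cst].
Qed.

(** In the application [S] is computed from a finite value of the supremum in the theorem, so one
    bound serves all unitary V and all d at once. *)
Variable S : R.
Hypothesis tau_S : forall (V : 'M[K]_r) d, ctr V *m V = 1%:M -> 0 < d -> d <= 1 ->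
  mean P (fun t => tau q d (V *m M t)) <= S.

Lemma mean_tau_ge0 (V : 'M[K]_r) d : ctr V *m V = 1%:M -> 0 < d ->
  0 <= mean P (fun t => tau q d (V *m M t)).
Proof.
move=> V1 d0; rewrite -[leLHS](mean_cst P); apply: mean_le => [||t].
- exact: bmeas_cst.
- exact: bmeas_tau.
- by apply: tau_ge0 => //; rewrite gram_unitary.
Qed.

Lemma mean_drift (V : 'M[K]_r) d : ctr V *m V = 1%:M -> 0 < d ->
  let e c := mean P (fun t => tau q c (V *m M t)) in
  mean P (fun t => drift q d (V *m M t)) =
  (l%:R - q%:R - al) * e d - ((r - q)%N%:R - al) * q%:R
  + (4 * q%:R + 4) * (e d - e (2 * d)) + (r - q)%N%:R * d * e d.
Proof.
move=> V1 d0 e; rewrite /drift.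
have d2 : 0 < 2 * d by rewrite mulr_gt0.
have b1 := bmeas_tau V1 d0; have b2 := bmeas_tau V1 d2.
set c1 := l%:R - _ - _; set c0 := _ * q%:R; set c2 := 4 * _ + _; set c3 := (r - q)%N%:R * d.
have bc : bmeas (fun _ : T => c0) by exact: bmeas_cst.
have bA := bmeasB (bmeasZ c1 b1) bc.
have bB := bmeasZ c2 (bmeasB b1 b2); have bC := bmeasZ c3 b1.
apply: (etrans (meanD P (bmeasD bA bB) bC)); congr (_ + _); last exact: meanZ.
apply: (etrans (meanD P bA bB)); congr (_ + _).
  by apply: (etrans (meanB P (bmeasZ c1 b1) bc)); rewrite meanZ // mean_cst.
by apply: (etrans (meanZ P c2 (bmeasB b1 b2))); congr (_ * _); exact: meanB.
Qed.

Lemma ctr_prefl_unit (i j : 'I_r) w p y : i != j -> p ^+ 2 + y ^+ 2 = 1 ->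
  w * sconj R k w = 1 -> ctr (prefl i j w p y) *m prefl i j w p y = 1%:M.
Proof.
move=> ij py w1; rewrite /prefl ctr_refl refl_sq //.
apply/matrixP => a b; rewrite !ord1 quad_ctr mxE mulr1n.
have sw : sabs w ^+ 2 = 1 by apply: (@sinj_inj R k); rewrite -mul_sconj w1 rmorph1.
rewrite (bigD1 i) //= (bigD1 j) 1?eq_sym //= big1 => [|t /andP[ti tj]]; last first.
  by rewrite !mxE (negbTE ti) (negbTE tj) !mulr0 addr0 sabs0 expr0n.
rewrite !mxE !eqxx [j == i]eq_sym (negbTE ij) /= !(mulr1, mulr0, addr0, add0r).
by rewrite sabsM exprMn sw !sabs_inj !real_normK ?num_real // mulr1 py rmorph1.
Qed.

(* Comparing a near-minimizer [V] of [V |-> \sum_u mean (logdet d_u (V M))] with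
   its rotations by the angle of sine [s] shows that the mean drift at [V] is
   at least [- O(s)]. *)
Lemma near_min_drift (U : finType) (d : U -> R) :
  (forall u, 0 < d u <= 1) ->
  exists2 B, 0 <= B & forall p, 0 < p -> p <= 2^-1 -> exists2 V : 'M[K]_r,
    ctr V *m V = 1%:M &
    - B * p <= \sum_u mean P (fun t => drift q (d u) (V *m M t)).
Proof.
move=> d01; have d0 u : 0 < d u by case/andP: (d01 u).
have d1 u : d u <= 1 by case/andP: (d01 u).
pose H (V : 'M[K]_r) := \sum_u mean P (fun t => logdet q (d u) (V *m M t)).
pose n : R := \sum_(i < r | (i < q)%N) \sum_(j < r | ~~ (j < q)%N)
   \sum_(w <- phases R k) 1.
pose rm : R := \sum_u sum_rem k r q (d u).
have n0 : 0 <= n by do 3 (rewrite sumr_ge0 // => ? _).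
have rm0 : 0 <= rm.
  by rewrite sumr_ge0 // => u _; do 3 (rewrite sumr_ge0 // => ? _); exact: rem_cst_ge0.
(* Here n counts the triples (i, j, w). Each second difference is at least -2 s^3, and their sum is
   at most 2 (2 - alpha) s^2 times the drift plus s^4 rm. Dividing by s^2 and using s <= 2 p and s
   <= 1 gives a bound linear in p; the factors 8 are generous. *)
exists (8 * n + 8 * rm); first by rewrite addr_ge0 // mulr_ge0.
move=> p p0 p2; pose y := Num.sqrt (1 - p ^+ 2); pose s := 2 * p * y.
have p21 : p ^+ 2 < 1 by rewrite expr_lt1 ?(ltW p0) // (le_lt_trans p2) // invf_lt1 // ltr1n.
have yy : y ^+ 2 = 1 - p ^+ 2 by rewrite sqr_sqrtr // subr_ge0 ltW.
have py : p ^+ 2 + y ^+ 2 = 1 by rewrite yy addrC subrK.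
have y0 : 0 < y by rewrite sqrtr_gt0 subr_gt0.
have s0 : 0 < s by rewrite !mulr_gt0.
have y1 : y <= 1 by rewrite -(@expr_le1 _ 2) ?(ltW y0) // yy gerBl sqr_ge0.
have s2p : s <= 2 * p by rewrite /s ler_piMr // mulr_ge0 // ltW.
have s1 : s <= 1 by apply: (le_trans s2p); rewrite -ler_pdivlMl // mulr1.
pose A := [set H V | V in [set V : 'M[K]_r | ctr V *m V = 1%:M]].
have infA : has_inf A.
  split; first by exists (H 1%:M); exists 1%:M => //=; rewrite ctr1 mulmx1.
  exists (\sum_u ln (d u ^+ l)) => _ [V /= V1 <-]; apply: ler_sum => u _.
  rewrite -[leLHS](mean_cst P); apply: mean_le => [||t].
  - exact: bmeas_cst.
  - exact: bmeas_logdet.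
  - have := logdet_bounds qr (M := V *m M t) _ (d0 u).
    by rewrite gram_unitary // => /(_ (M_free t)) /andP[].
have s30 : 0 < s ^+ 3 by rewrite exprn_gt0.
have [_ [V /= V1 <-] HV] := inf_adherent s30 infA.
exists V => //.
have Hrot (i j : 'I_r) w (z : R) : (i < q)%N -> ~~ (j < q)%N -> w \in phases R k ->
    p ^+ 2 + z ^+ 2 = 1 -> H V - s ^+ 3 <= H (prefl i j w p z *m V).
  move=> iq jq wp pz; have ij : i != j by apply: contraNneq jq => <-.
  rewrite lerBlDr (le_trans (ltW HV)) // lerD2r.
  apply: ge_inf; first by case: infA.
  by exists (prefl i j w p z *m V) => //=; rewrite ctrM mulmxA -(mulmxA (ctr V))
    ctr_prefl_unit ?mulmx1 // phases_unit.
pose inc (u : U) t := \sum_(i < r | (i < q)%N) \sum_(j < r | ~~ (j < q)%N)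
  \sum_(w <- phases R k)
    (logdet q (d u) (prefl i j w p y *m (V *m M t)) +
     logdet q (d u) (prefl i j w p (- y) *m (V *m M t)) - 2 * logdet q (d u) (V *m M t)).
have pyN : p ^+ 2 + (- y) ^+ 2 = 1 by rewrite sqrrN.
have bterm u (i j : 'I_r) w z : (i < q)%N -> ~~ (j < q)%N -> w \in phases R k ->
    p ^+ 2 + z ^+ 2 = 1 -> bmeas (fun t => logdet q (d u) (prefl i j w p z *m (V *m M t))).
  move=> iq jq wp pz; have ij : i != j by apply: contraNneq jq => <-.
  rewrite (_ : (fun t => _) = (fun t => logdet q (d u) ((prefl i j w p z *m V) *m M t))).
    apply: bmeas_logdet => //; rewrite ctrM mulmxA -(mulmxA (ctr V)).
    by rewrite ctr_prefl_unit ?mulmx1 // phases_unit.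
  by apply/funext => t; rewrite mulmxA.
have b0 u : bmeas (fun t => 2 * logdet q (d u) (V *m M t)).
  by apply: bmeasZ; exact: bmeas_logdet.
have bw u (i j : 'I_r) w : (i < q)%N -> ~~ (j < q)%N -> w \in phases R k ->
    bmeas (fun t => logdet q (d u) (prefl i j w p y *m (V *m M t)) +
     logdet q (d u) (prefl i j w p (- y) *m (V *m M t)) - 2 * logdet q (d u) (V *m M t)).
  by move=> iq jq wp; apply: bmeasB => //; apply: bmeasD; exact: bterm.
have binc u : bmeas (inc u).
  by do 2 (apply: bmeas_sum => ? ?); apply: bmeas_sum_seq => w wp; exact: bw.
have incE : \sum_u mean P (inc u) = \sum_(i < r | (i < q)%N) \sum_(j < r | ~~ (j < q)%N)
    \sum_(w <- phases R k)
      (H (prefl i j w p y *m V) + H (prefl i j w p (- y) *m V) - 2 * H V).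
  transitivity (\sum_u \sum_(i < r | (i < q)%N) \sum_(j < r | ~~ (j < q)%N)
    \sum_(w <- phases R k)
      mean P (fun t => logdet q (d u) (prefl i j w p y *m (V *m M t)) +
       logdet q (d u) (prefl i j w p (- y) *m (V *m M t)) - 2 * logdet q (d u) (V *m M t))).
    by apply: eq_bigr => u _; apply: mean_sum3 => i j w; exact: bw.
  rewrite exchange_big; apply: eq_bigr => i iq; rewrite exchange_big; apply: eq_bigr => j jq.
  rewrite exchange_big /= !big_seq; apply: eq_bigr => w wp.
  rewrite /H mulr_sumr -big_split -sumrB; apply: eq_bigr => u _ /=.
  have E z : mean P (fun t => logdet q (d u) (prefl i j w p z *m V *m M t)) =
      mean P (fun t => logdet q (d u) (prefl i j w p z *m (V *m M t))).
    by congr (mean P _); apply/funext => t; rewrite mulmxA.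
  have B1 := bterm u i j w y iq jq wp py; have B2 := bterm u i j w (- y) iq jq wp pyN.
  transitivity (mean P (fun t => logdet q (d u) (prefl i j w p y *m (V *m M t))) +
    mean P (fun t => logdet q (d u) (prefl i j w p (- y) *m (V *m M t))) -
    2 * mean P (fun t => logdet q (d u) (V *m M t))).
    exact: (mean_second_diff P B1 B2 (bmeas_logdet V1 (d0 u))).
  by apply: (congr2 (fun a b => a + b - _)); symmetry; exact: E.
clear infA HV A; clearbody H.
have inc_ge : - (2 * s ^+ 3 * n) <= \sum_u mean P (inc u).
  have aux (a b c e : R) : c - e <= a -> c - e <= b -> - (2 * e) * 1 <= a + b - 2 * c.
    by move=> ? ?; lra.
  rewrite incE /n -mulNr mulr_sumr.
  apply: ler_sum => i iq; rewrite mulr_sumr; apply: ler_sum => j jq.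
  rewrite mulr_sumr !big_seq; apply: ler_sum => w wp.
  by apply: aux; apply: Hrot.
have inc_le u : mean P (inc u) <=
    2 * (2 - al) * s ^+ 2 * mean P (fun t => drift q (d u) (V *m M t)) +
    s ^+ 4 * sum_rem k r q (d u).
  have bd := bmeasZ (2 * (2 - al) * s ^+ 2) (bmeas_drift V1 (d0 u)).
  have bc : bmeas (fun _ : T => s ^+ 4 * sum_rem k r q (d u)) by exact: bmeas_cst.
  apply: (le_trans (mean_le P (binc u) (bmeasD bd bc) _)) => [t|].
    by apply: sum_logdet_incr => //; rewrite gram_unitary.
  rewrite le_eqVlt; apply/orP; left; apply/eqP.
  apply: (etrans (meanD P bd bc)); congr (_ + _); last exact: mean_cst.
  by apply: meanZ; exact: bmeas_drift.
have : - (2 * s ^+ 3 * n) <=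
    2 * (2 - al) * s ^+ 2 * (\sum_u mean P (fun t => drift q (d u) (V *m M t))) + s ^+ 4 * rm.
  apply: (le_trans inc_ge); rewrite /rm !mulr_sumr -big_split /=.
  by apply: ler_sum => u _; exact: inc_le.
move: (\sum_u _) n rm n0 rm0 {inc_le inc_ge} => D N B N0 B0 main.
have s2 : 0 < s ^+ 2 by rewrite exprn_gt0.
have {main} : 0 <= 2 * (2 - al) * D + s ^+ 2 * B + 2 * s * N.
  rewrite -(pmulr_rge0 _ s2).
  rewrite (_ : s ^+ 2 * (_ + _) =
    2 * (2 - al) * s ^+ 2 * D + s ^+ 4 * B + 2 * s ^+ 3 * N); last by ring.
  by rewrite -lerBlDr sub0r.
have e1 : s * N <= 2 * p * N by rewrite ler_wpM2r.
have e2 : s ^+ 2 * B <= 2 * p * B.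
  by apply: ler_wpM2r => //; rewrite (le_trans _ s2p) // expr2 ler_piMl // ltW.
have pN : 0 <= p * N by rewrite mulr_ge0 // ltW.
have pB : 0 <= p * B by rewrite mulr_ge0 // ltW.
by case: (k) => /= H0; lra.
Qed.

(** Sum the mean drifts over d = 2^u / 2^N for u < N. The differences of [tau] telescope and the d
    add up to at most 1, so the errors total at most C, whatever N is. Near-minimizers make the sum
    at least -B p for all small p, whence N X + C >= 0 for every N and X >= 0. *)
Lemma mean_tau_bound : ((r - q)%N%:R - al) * q%:R <= (l%:R - q%:R - al) * S.
Proof.
have S0 : 0 <= S.
  have I1 : ctr (1%:M : 'M[K]_r) *m 1%:M = 1%:M by rewrite ctr1 mulmx1.
  by apply: le_trans (tau_S I1 ltr01 (lexx 1)); exact: mean_tau_ge0.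
set X := (l%:R - q%:R - al) * S - ((r - q)%N%:R - al) * q%:R.
set C := (4 * q%:R + 4) * S + (r - q)%N%:R * S.
have coef : 0 <= l%:R - q%:R - al :> R.
  by rewrite -addrA -opprD -natrD subr_ge0 ler_nat.
suff main (N : nat) : (0 < N)%N -> 0 <= N%:R * X + C.
  rewrite -subr_ge0 -/X leNgt; apply/negP => X0.
  have C0 : 0 <= C by rewrite addr_ge0 ?mulr_ge0 ?addr_ge0 ?mulr_ge0.
  have := archi_boundP (divr_ge0 C0 (ltW (_ : 0 < - X))); rewrite oppr_gt0 X0 => /(_ isT).
  set N := Num.bound _ => CN.
  have N0 : (0 < N)%N.
    rewrite -(ltr_nat R); apply: le_lt_trans CN; rewrite divr_ge0 // oppr_ge0 ltW //.
  have := main N N0; rewrite ltr_pdivrMr ?oppr_gt0 // in CN.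
  lra.
move=> N0; pose d (u : nat) : R := 2 ^+ u / 2 ^+ N.
have d0 u : 0 < d u by rewrite divr_gt0 ?exprn_gt0.
have dS u : d u.+1 = 2 * d u by rewrite /d exprS mulrA.
have d1 (u : nat) : (u <= N)%N -> d u <= 1.
  by move=> uN; rewrite /d ler_pdivrMr ?exprn_gt0 // mul1r ler_eXn2l ?ltr1n.
have sumd n : \sum_(u < n) d u = d n - d 0.
  elim: n => [|n IH]; first by rewrite big_ord0 subrr.
  by rewrite big_ord_recr /= IH dS; ring.
have [|B B0 HB] := @near_min_drift 'I_N (fun u => d u).
  by move=> u; rewrite d0 d1 // ltnW.
(* B depends on N but not on p, so p can tend to 0 with N fixed; V varies with p, but the right side
   does not involve it. *)
suff lower p : 0 < p -> p <= 2^-1 -> - B * p <= N%:R * X + C.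
  rewrite leNgt; apply/negP => neg.
  pose Y := - (N%:R * X + C); have Y0 : 0 < Y by rewrite oppr_gt0.
  pose p := Num.min 2^-1 (Y / (2 * (B + 1))).
  have B1 : 0 < 2 * (B + 1) by rewrite mulr_gt0 // ltr_wpDl.
  have p0 : 0 < p by rewrite lt_min invr_gt0 ltr0n divr_gt0.
  have p2 : p <= 2^-1 by rewrite ge_min lexx.
  have pY : p * (2 * (B + 1)) <= Y by rewrite -ler_pdivlMr // ge_min lexx orbT.
  have YB : Y <= B * p by rewrite -lerN2 -mulNr opprK; exact: lower.
  have := mulr_ge0 B0 (ltW p0) => Bp.
  by clearbody Y p; lra.
move=> p0 p2; have [V V1 /le_trans] := HB p p0 p2; apply.
pose e c := mean P (fun t => tau q c (V *m M t)).
have e0 u : 0 <= e (d u) by exact: mean_tau_ge0.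
have eS (u : nat) : (u <= N)%N -> e (d u) <= S by move=> uN; apply: tau_S => //; exact: d1.
have tel n : \sum_(u < n) (e (d u) - e (d u.+1)) = e (d 0) - e (d n).
  elim: n => [|n IH]; first by rewrite big_ord0 subrr.
  by rewrite big_ord_recr /= IH addrA subrK.
apply: le_trans (_ : \sum_(u < N) (X + (4 * q%:R + 4) * (e (d u) - e (d u.+1)) +
    (r - q)%N%:R * S * d u) <= _).
  apply: ler_sum => u _; rewrite mean_drift // -/(e _) -/(e _) -dS.
  have uN : (u <= N)%N by rewrite ltnW.
  apply: lerD; last first.
    by rewrite mulrAC; apply: ler_wpM2r; [exact: ltW|apply: ler_wpM2l; [|exact: eS]].
  by rewrite lerD2r /X lerD2r; apply: ler_wpM2l => //; exact: eS.
rewrite 2!big_split /= sumr_const card_ord -[X *+ N]mulr_natl -2!mulr_sumr tel sumd.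
rewrite -addrA lerD2l /C; apply: lerD.
  apply: ler_wpM2l; first by rewrite addr_ge0 // mulr_ge0.
  by rewrite lerBlDr (le_trans (eS 0%N _)) // lerDl.
apply: ler_piMr; first by rewrite mulr_ge0.
by rewrite lerBlDr (le_trans (d1 N _)) // lerDl ltW.
Qed.

End Core.

(** * Compression to r coordinates *)

Section NullParameter.
Variables (R : realType) (disp : measure_display) (T : measurableType disp).
Variable P : probability T R.

Lemma bmeas_indic (B : set T) : measurable B -> bmeas (\1_B : T -> R).
Proof.
move=> mB; split; first exact: measurable_indic.
by exists 1 => t; rewrite indicE; case: (_ \in _); rewrite ?normr1 ?normr0.
Qed.

Lemma mean_indic (B : set T) : measurable B -> mean P (\1_B) = fine (P B).
Proof. by move=> mB; rewrite /mean /Rintegral integral_indic // setIT. Qed.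

(* Only countably many of the [B x] can be non-negligible, since no point lies
   in more than [r] of them. *)
Lemma exists_null_parameter (B : R -> set T) (r : nat) :
  (forall x, measurable (B x)) ->
  (forall t (s : seq R), uniq s -> (forall x, x \in s -> 1 <= x /\ B x t) -> (size s <= r)%N) ->
  exists2 x, 1 <= x & P (B x) = 0%E.
Proof.
move=> mB Br; apply: contrapT => nex.
have PB x : 1 <= x -> 0 < fine (P (B x)).
  move=> x1; rewrite fine_gt0 // lt0e measure_ge0 andbT.
  apply/andP; split; first by apply/eqP => P0; apply: nex; exists x.
  by rewrite (le_lt_trans (probability_le1 P (mB x))) // ltry.
pose A m := [set x : R | 1 <= x /\ (m.+1%:R)^-1 <= fine (P (B x))].
have A_fin m : finite_set (A m).
  (* With (r + 1) (m + 1) such parameters, the number of their sets containing a point would have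
     mean at least r + 1, although it never exceeds r. *)
  apply: contrapT => /(infinite_set_fset (r.+1 * m.+1)) [fs sA].
  have := finmap.fset_uniq fs; set s := finmap.enum_fset fs => su ss.
  have sAx x : x \in s -> A m x by move=> xs; apply: sA.
  have sum_le : mean P (fun t => \sum_(x <- s) \1_(B x) t) <= r%:R.
    rewrite -[leRHS](mean_cst P); apply: mean_le => [||t].
    - by apply: bmeas_sum => x _; exact: bmeas_indic.
    - exact: bmeas_cst.
    - pose s' := [seq x <- s | t \in B x].
      have -> : \sum_(x <- s) \1_(B x) t = (size s')%:R :> R.
        rewrite size_filter -sum1_count natr_sum [RHS]big_mkcond; apply: eq_bigr => x _.
        by rewrite indicE; case: (t \in B x).
      rewrite ler_nat; apply: (Br t); first exact: filter_uniq.
      by move=> x; rewrite mem_filter => /andP[/set_mem Bt /sAx []].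
  have : (r.+1%:R : R) <= r%:R.
    apply: le_trans sum_le; rewrite mean_sum => [|x _]; last exact: bmeas_indic.
    apply: le_trans (_ : \sum_(x <- s) (m.+1%:R)^-1 <= _).
      rewrite big_const_seq count_predT iter_addr_0 -[_ *+ size _]mulr_natr.
      rewrite ler_pdivlMl // -natrM ler_nat.
      by rewrite mulnC.
    rewrite big_seq [leRHS]big_seq; apply: ler_sum => x /sAx [_ xm].
    by rewrite mean_indic.
  by rewrite ler_nat ltnn.
have cA : countable (\bigcup_m A m).
  by apply: bigcup_countable => [|m _]; [exact: countableP|exact: finite_set_countable].
(* The countable union would contain an interval of Lebesgue measure one. *)
have sub : `[1, 2]%classic `<=` \bigcup_m A m.
  move=> x /=; rewrite in_itv /= => /andP[x1 _].
  have p0 := PB x x1; have := archi_boundP (ltW (_ : 0 < (fine (P (B x)))^-1)).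
  rewrite invr_gt0 p0 => /(_ isT); set m := Num.bound _ => xm.
  exists m => //; split => //; rewrite -[leRHS]invrK lef_pV2 ?posrE ?invr_gt0 //.
  by rewrite (le_trans (ltW xm)) // ler_nat.
have := countable_lebesgue_measure0 (sub_countable (subset_card_le sub) cA).
rewrite lebesgue_measure_itv /= lte_fin ltr1n /= -EFinD => /eqP.
by rewrite eqe => /eqP e; lra.
Qed.

End NullParameter.

(** * Unitary changes of coordinates that preserve the rank almost surely *)

Section Householder.
Variables (R : realType) (k : scalar_kind).
Local Notation K := (scalar_field R k).
Local Notation inj := (sinj R k).

(** The reflection along u - |u| e, with e the basis vector of index r, exchanges e and u / |u|. It
    commutes with [pid_mx r.+1] because this vector is supported on the first r + 1 coordinates. *)
Lemma moment_householder n r (rn : (r < n)%N) (x : R) : (0 < r)%N -> 1 <= x ->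
  let u : 'cV[K]_n := \col_(i < n) (if (i <= r)%N then inj (x ^+ i) else 0) in
  exists H : 'M[K]_n, [/\ ctr H = H, H *m H = 1%:M,
    H *m pid_mx r.+1 = pid_mx r.+1 *m H &
    exists nu, H *m delta_mx (Ordinal rn) 0 = nu *: u].
Proof.
move=> r0 x1 u; have x0 : 0 < x by exact: lt_le_trans x1.
pose nu2 : R := \sum_(i < n) (if (i <= r)%N then x ^+ i ^+ 2 else 0).
pose nu := Num.sqrt nu2; pose e := Ordinal rn.
have xi0 i : 0 < x ^+ i by rewrite exprn_gt0.
have n0 : (0 < n)%N by exact: (leq_ltn_trans (leq0n r) rn).
have nu2_ge i : 0 <= (if (i <= r)%N then x ^+ i ^+ 2 else 0 : R).
  by case: ifP => // _; rewrite sqr_ge0.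
(* Coordinate 0, with entry 1, differs from coordinate r since r > 0; so u is not a multiple of e
   and the reflection is defined. *)
have nu2_gt : x ^+ r ^+ 2 < nu2.
  rewrite /nu2 (bigD1 e) //= leqnn ltrDl (bigD1 (Ordinal n0)) //=; last first.
    by rewrite -val_eqE /= neq_ltn r0.
  by rewrite expr0 expr1n ltr_pwDl // sumr_ge0.
have nuE : nu ^+ 2 = nu2 by rewrite sqr_sqrtr // (le_trans _ (ltW nu2_gt)) // sqr_ge0.
have nu_gt : x ^+ r < nu by rewrite -ltr_sqr ?nnegrE ?(ltW (xi0 r)) ?sqrtr_ge0 // nuE.
have nu0 : 0 < nu by exact: lt_trans nu_gt.
(* The squared norm of u - nu e, where nu = |u| and u has entry x^r at e. *)
pose ga := 2 * nu * (nu - x ^+ r).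
have ga0 : 0 < ga by rewrite !mulr_gt0 // subr_gt0.
pose g (i : 'I_n) : R := (if (i <= r)%N then x ^+ i else 0) - (if i == e then nu else 0).
have g2 : \sum_i g i ^+ 2 = ga.
  rewrite (bigD1 e) //= /g eqxx leqnn.
  rewrite (eq_bigr (fun i : 'I_n => if (i <= r)%N then x ^+ i ^+ 2 else 0)); last first.
    by move=> i /negbTE ->; rewrite subr0; case: ifP => // _; rewrite expr0n.
  have : nu2 = x ^+ r ^+ 2 + \sum_(i < n | i != e) (if (i <= r)%N then x ^+ i ^+ 2 else 0).
    by rewrite /nu2 (bigD1 e) //= leqnn.
  rewrite -nuE => /(canLR (addKr _)) <-; rewrite /ga; ring.
pose w : 'rV[K]_n := \row_i inj (g i / Num.sqrt ga).
have sga : Num.sqrt ga ^+ 2 = ga by rewrite sqr_sqrtr // ltW.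
have sga0 : Num.sqrt ga != 0 by rewrite gt_eqF // sqrtr_gt0.
have w1 : w *m ctr w = 1%:M.
  apply/matrixP => a b; rewrite !ord1 quad_ctr mxE mulr1n -(rmorph1 inj); congr (inj _).
  rewrite (eq_bigr (fun i => ga^-1 * g i ^+ 2)) => [|i _]; last first.
    by rewrite mxE sabs_inj real_normK ?num_real // expr_div_n sga mulrC.
  by rewrite -mulr_sumr g2 mulVf // gt_eqF.
have gr (i : 'I_n) : (r < i)%N -> g i = 0.
  move=> ri; rewrite /g leqNgt ri /= (_ : i == e = false) ?subrr //.
  by apply/negbTE; rewrite -val_eqE /= gtn_eqF.
have wp : w *m pid_mx r.+1 = w.
  apply/rowP => j; rewrite mxE (bigD1 j) //= big1 => [|i ij]; last first.
    by rewrite [pid_mx _ _ _]mxE (negbTE (_ : (i : nat) != j)) ?mulr0.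
  rewrite addr0 !mxE eqxx /= ltnS; case: leqP => [_|rj]; first by rewrite mulr1.
  by rewrite mulr0 gr // mul0r rmorph0.
exists (refl w); split.
- exact: ctr_refl.
- exact: refl_sq.
- have pw : pid_mx r.+1 *m ctr w = ctr w.
    rewrite -[in RHS]wp ctrM; congr (_ *m _); apply/matrixP => i j.
    by rewrite ctrE !mxE rmorph_nat [(j : nat) == i]eq_sym; case: eqP => [->|].
  by rewrite /refl mulmxBl mulmxBr mul1mx mulmx1 -scalemxAl -scalemxAr -mulmxA wp mulmxA pw.
exists (inj nu^-1); apply/colP => i.
rewrite /refl mulmxBl mul1mx -scalemxAl -mulmxA.
have we : w *m delta_mx e 0 = (inj (g e / Num.sqrt ga))%:M.
  by rewrite [LHS]mx11_scalar -colE !mxE.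
rewrite we mul_mx_scalar !mxE eqxx andbT sconj_inj -/e.
have -> : (i == e)%:R = inj (i == e)%:R by rewrite rmorph_nat.
have -> : (if (i <= r)%N then inj (x ^+ i) else 0) = inj (if (i <= r)%N then x ^+ i else 0).
  by case: ifP; rewrite ?rmorph0.
rewrite -(rmorph_nat inj 2) -!rmorphM -rmorphB; congr (inj _).
have -> : 2 * (g e / Num.sqrt ga * (g i / Num.sqrt ga)) = 2 * g e * g i / ga.
  by rewrite -[in RHS]sga; field.
have d0 : nu - x ^+ r != 0 by rewrite subr_eq0 gt_eqF.
have nun : nu != 0 by rewrite gt_eqF.
rewrite /ga /g eqxx /= leqnn; case: (i == e) => /=; move: (if _ then _ else _) => U;
  by move: (x ^+ r) d0 => X d0; field; rewrite ?nun ?d0.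
Qed.

Lemma rank_col_kernel m n (A : 'M[K]_(m, n)) :
  \rank A <> n -> exists2 c : 'cV[K]_n, c != 0 & A *m c = 0.
Proof.
move=> rA; have : kermx A^T != 0.
  by rewrite kermx_eq0 /row_free mxrank_tr; apply/eqP.
move=> /rowV0Pn [v /sub_kermxP vA v0]; exists v^T; first by rewrite trmx_eq0.
by apply: trmx_inj; rewrite trmx_mul trmxK vA trmx0.
Qed.

Lemma rank_col_inj m n (A : 'M[K]_(m, n)) (c : 'cV[K]_n) :
  \rank A = n -> A *m c = 0 -> c = 0.
Proof.
move=> rA Ac; apply: trmx_inj; rewrite trmx0.
have Af : row_free A^T by rewrite /row_free mxrank_tr rA.
by apply: (row_free_inj Af); rewrite mul0mx -trmx_mul Ac trmx0.
Qed.

Variables (disp : measure_display) (T : measurableType disp) (P : probability T R).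

(* The range of [Y t] contains [(1, x, .., x^r)] for at most [r] values of [x]; for
   the other ones, reflecting this vector to the last of the [r.+1] coordinates
   and dropping that coordinate preserves the rank. *)
Lemma ae_full_rank_step n l r (V : 'M[K]_n) (X : T -> 'M[K]_(n, l)) :
  (0 < l <= r)%N -> (r < n)%N -> random_matrix X -> ctr V *m V = 1%:M ->
  {ae P, forall t, \rank (pid_mx r.+1 *m V *m X t : 'M[K]_(n, l)) = l} ->
  exists2 V' : 'M[K]_n, ctr V' *m V' = 1%:M &
  {ae P, forall t, \rank (pid_mx r *m V' *m X t : 'M[K]_(n, l)) = l}.
Proof.
move=> /andP[l0 lr] rn mX V1 aeV.
have r0 : (0 < r)%N by exact: leq_trans lr.
have /choice [H HP] : forall x : R, exists H : 'M[K]_n, 1 <= x -> [/\ ctr H = H, H *m H = 1%:M,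
    H *m pid_mx r.+1 = pid_mx r.+1 *m H &
    exists nu, H *m delta_mx (Ordinal rn) 0 =
      nu *: \col_(i < n) (if (i <= r)%N then inj (x ^+ i) else 0)].
  move=> x; have [x1|x1] := boolP (1 <= x); last by exists 0.
  by have [H HH] := moment_householder rn r0 x1; exists H.
pose Y t := pid_mx r.+1 *m V *m X t : 'M[K]_(n, l).
pose Z x t := pid_mx r *m (H x *m V) *m X t : 'M[K]_(n, l).
pose full (W : T -> 'M[K]_(n, l)) := [set t | ctr (W t) *m W t \in unitmx].
have mY : measurable (full Y) by apply: measurable_gram_unit; apply: rmxM => //; exact: rmx_cst.
have mZ x : measurable (full (Z x)).
  by apply: measurable_gram_unit; apply: rmxM => //; exact: rmx_cst.
have PY : P (~` full Y) = 0%E.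
  apply/negligibleP; first exact: measurableC.
  by apply: negligibleS aeV => t /= nf rf; apply: nf; rewrite /full /= gram_unit; apply/eqP.
have [||x x1 Px] := @exists_null_parameter R disp T P (fun x => full Y `&` ~` full (Z x)) r.
- by move=> x; apply: measurableI => //; exact: measurableC.
- move=> t s us sP; case: s us sP => // x0 s us sP.
  have rY : \rank (Y t) = l.
    by have [_ [+ _]] := sP x0 (mem_head _ _); rewrite /full /= gram_unit => /eqP.
  pose Z0 : 'M[K]_(r.+1, n) := pid_mx r.+1.
  have : kermx (Z0 *m Y t) != 0.
    rewrite kermx_eq0 /row_free neq_ltn (leq_ltn_trans (mxrankM_maxr _ _)) //.
    by rewrite rY ltnS.
  move=> /rowV0Pn [y /sub_kermxP yZ y0].
  (* As l <= r, some nonzero row y annihilates the range in the first r + 1 coordinates. Its pairing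
     with (1, x, .., x^r) is the value at x of a nonzero polynomial of degree at most r, so every
     bad x is a root. *)
  pose p := rVpoly y.
  have p0 : p != 0 by apply: contra_neq y0 => p0; rewrite -[y]rVpolyK -/p p0 linear0.
  have sp : (size p <= r.+1)%N by exact: size_poly.
  rewrite -ltnS; apply: leq_trans sp; rewrite -(size_map inj).
  apply: max_poly_roots => //; last by rewrite map_inj_uniq //; exact: sinj_inj.
  apply/allP => _ /mapP [x xs ->]; have [x1 [_ nZ]] := sP x xs.
  have [Hs H2 Hp [nu Hnu]] := HP x x1.
  (* A rank loss gives c for which H Y c has only its coordinate r left; applying H once more, Y c
     is a multiple of the moment vector. *)
  have [c c0 Zc] : exists2 c : 'cV[K]_l, c != 0 & Z x t *m c = 0.
    by apply: rank_col_kernel => rZ; apply: nZ; rewrite /full /= gram_unit rZ.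
  pose e := Ordinal rn; pose b := H x *m (Y t *m c).
  have bE : b = b e 0 *: delta_mx e 0.
    have b1 : b = pid_mx r.+1 *m (H x *m V *m X t *m c).
      by rewrite /b /Y !mulmxA Hp.
    have pidE j (W : 'cV[K]_n) (i : 'I_n) :
        ((pid_mx j : 'M[K]_n) *m W) i 0 = if (i < j)%N then W i 0 else 0.
      rewrite mxE (bigD1 i) //= big1 => [|h hi]; last first.
        by rewrite [pid_mx _ _ _]mxE (negbTE (_ : (i : nat) != h)) ?mul0r // eq_sym.
      by rewrite addr0 mxE eqxx /=; case: ifP; rewrite ?mul1r ?mul0r.
    apply/colP => i; rewrite [RHS]mxE [delta_mx _ _ _ _]mxE eqxx andbT.
    case: eqP => [->|/eqP ie]; first by rewrite mulr1.
    rewrite mulr0 b1 pidE ltnS leq_eqVlt; move: ie; rewrite -val_eqE /= => /negbTE -> /=.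
    case: ifP => // ir.
    have Zc' : (pid_mx r : 'M[K]_n) *m (H x *m V *m X t *m c) = 0.
      by rewrite -Zc /Z !mulmxA.
    by move: Zc' => /colP /(_ i); rewrite pidE ir => ->; rewrite mxE.
  have Yc : Y t *m c = (b e 0 * nu) *: (\col_(i < n) (if (i <= r)%N then inj (x ^+ i) else 0)).
    by rewrite -scalerA -Hnu scalemxAr -bE /b (mulmxA (H x) (H x)) H2 mul1mx.
  have bnu : b e 0 * nu != 0.
    by apply: contra_neq c0 => b0; apply: (rank_col_inj rY); rewrite Yc b0 scale0r.
  have : y *m Z0 *m (Y t *m c) = 0 by rewrite mulmxA -(mulmxA y) yZ mul0mx.
  rewrite Yc -scalemxAr => /eqP; rewrite scalemx_eq0 (negbTE bnu) /= => /eqP.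
  move=> /matrixP /(_ 0 0); rewrite [RHS]mxE => yu.
  apply/rootP; rewrite -{}yu /p (horner_coef_wide _ (size_poly _ _)).
  rewrite -mulmxA mxE; apply: eq_bigr => j _; rewrite coef_rVpoly_ord; congr (_ * _).
  have jn : (j < n)%N by rewrite (leq_trans (ltn_ord j)).
  rewrite mxE (bigD1 (Ordinal jn)) //= big1 => [|h hj]; last first.
    by rewrite [Z0 _ _]mxE (negbTE (_ : (j : nat) != h)) ?mul0r // eq_sym.
  rewrite addr0 !mxE eqxx ltn_ord mul1r /= ifT ?rmorphXn //.
  by rewrite -ltnS.
have [Hs H2 Hp _] := HP x x1.
exists (H x *m V); first by rewrite ctrM mulmxA -(mulmxA (ctr V)) Hs H2 mulmx1.
apply: (@negligibleS _ _ _ P ((full Y `&` ~` full (Z x)) `|` ~` full Y)).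
  move=> t /= nr; have [fY|] := pselect (full Y t); last by right.
  by left; split => // fZ; apply: nr; move: fZ; rewrite /full /= gram_unit => /eqP.
apply: negligibleU; apply/negligibleP => //.
- by apply: measurableI => //; exact: measurableC.
- exact: measurableC.
Qed.

(** Coordinates are dropped one at a time from n down to r; writing r as n - (n - r) turns this into
    an induction on the number of dropped coordinates. *)
Lemma ae_full_rank_unitary n l r (X : T -> 'M[K]_(n, l)) :
  (0 < l <= r)%N -> (r <= n)%N -> random_matrix X ->
  {ae P, forall t, \rank (X t) = l} ->
  exists2 V : 'M[K]_n, ctr V *m V = 1%:M &
  {ae P, forall t, \rank (pid_mx r *m V *m X t : 'M[K]_(n, l)) = l}.
Proof.
move=> /andP[l0 lr] rn mX aeX; rewrite -(subKn rn).
have : (n - (n - r) >= l)%N by rewrite subKn.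
elim: (n - r)%N => [_|j IH lj].
  exists 1%:M; first by rewrite ctr1 mulmx1.
  by apply: filterS aeX => t; rewrite subn0 pid_mx_1 !mul1mx.
have jn : (j < n)%N by rewrite -subn_gt0 (leq_trans l0) // (leq_trans lj) // leq_sub2l.
have [V V1 aeV] := IH (leq_trans lj (leq_sub2l n (leqnSn j))).
apply: (@ae_full_rank_step n l (n - j.+1) V) => //.
- by rewrite l0 lj.
- by rewrite ltn_subrL /= (leq_ltn_trans _ jn).
- by rewrite subnSK.
Qed.

End Householder.

(** * Singular values and projections *)

Lemma char_poly_conj (F : comUnitRingType) n (P Q A : 'M[F]_n) :
  P *m Q = 1%:M -> char_poly (P *m A *m Q) = char_poly A.
Proof.
move=> PQ; rewrite /char_poly.
have -> : char_poly_mx (P *m A *m Q) =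
    map_mx polyC P *m char_poly_mx A *m map_mx polyC Q.
  rewrite /char_poly_mx mulmxBr mulmxBl !map_mxM; congr (_ - _).
  by rewrite scalar_mxC -mulmxA -map_mxM PQ map_mx1 mulmx1.
rewrite !det_mulmx mulrAC -det_mulmx -map_mxM PQ map_mx1 det1 mul1r //.
Qed.

Section SVD.
Local Open Scope sesquilinear_scope.
Variables (R : realType) (k : scalar_kind).
Local Notation K := (scalar_field R k).
Local Notation inj := (sinj R k).

Lemma frob_trace m n (A : 'M[K]_(m, n)) : inj (frobenius A ^+ 2) = \tr (A *m ctr A).
Proof.
rewrite /frobenius sqr_sqrtr; last first.
  by rewrite sumr_ge0 // => i _; rewrite sumr_ge0 // => j _; rewrite sqr_ge0.
by rewrite raddf_sum; apply: eq_bigr => i _; rewrite quad_ctr.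
Qed.

Lemma frobenius_diag m n (s : nat -> R) :
  frobenius (diag_sv k m n s) ^+ 2 = \sum_(i < m | (i < n)%N) s i ^+ 2.
Proof.
rewrite /frobenius sqr_sqrtr; last first.
  by rewrite sumr_ge0 // => i _; rewrite sumr_ge0 // => j _; rewrite sqr_ge0.
rewrite [RHS]big_mkcond; apply: eq_bigr => i _.
case: ltnP => ni.
  rewrite (bigD1 (Ordinal ni)) //= mxE eqxx sabs_inj real_normK ?num_real //.
  rewrite big1 ?addr0 // => j ij; rewrite mxE ifN ?sabs0 ?expr0n // eq_sym.
  by move: ij; rewrite -val_eqE.
rewrite big1 // => j _; rewrite mxE ifN ?sabs0 ?expr0n //.
by rewrite neq_ltn (leq_trans (ltn_ord j) ni) orbT.
Qed.

Lemma frobenius_unitary m n (U : 'M[K]_m) (A : 'M[K]_(m, n)) (V : 'M[K]_n) :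
  unitary U -> unitary V -> frobenius (U *m A *m ctr V) ^+ 2 = frobenius A ^+ 2.
Proof.
move=> U1 V1; apply: (@sinj_inj R k); rewrite !frob_trace !ctrM ctrK.
have V2 : ctr V *m V = 1%:M by exact: mulmx1C V1.
have U2 : ctr U *m U = 1%:M by exact: mulmx1C U1.
rewrite mulmxA -(mulmxA _ (ctr V) V) V2 mulmx1 mulmxA mxtrace_mulC !mulmxA.
by rewrite U2 mul1mx.
Qed.

(** The spectrum of A A^* with multiplicity: if m > n, it is padded with zeros. *)
Definition sv_sqr m n (s : nat -> R) : seq R :=
  [seq (if (i < n)%N then s i ^+ 2 else 0) | i <- iota 0 m].

Lemma svd_char_poly m n (A : 'M[K]_(m, n)) U s V : is_svd A U s V ->
  char_poly (A *m ctr A) = \prod_(x <- map inj (sv_sqr m n s)) ('X - x%:P).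
Proof.
case=> U1 V1 _ _ ->; rewrite !ctrM -/(ctr V) ctrK.
have V2 : ctr V *m V = 1%:M by exact: mulmx1C V1.
rewrite mulmxA -(mulmxA _ (ctr V) V) V2 mulmx1 mulmxA -(mulmxA U) char_poly_conj //.
have -> : diag_sv k m n s *m ctr (diag_sv k m n s) =
    diag_mx (\row_(i < m) inj (if (i < n)%N then s i ^+ 2 else 0)).
  apply/matrixP => i j; rewrite mxE [RHS]mxE mxE.
  case: ltnP => ni.
    rewrite (bigD1 (Ordinal ni)) //= big1 => [|h ih]; last first.
      rewrite mxE ifN ?mul0r // eq_sym; by move: ih; rewrite -val_eqE.
    rewrite addr0 mxE eqxx ctrE mxE /= [(j : nat) == i]eq_sym -[(i : nat) == j]/(i == j :> nat).
    case: eqVneq => [/val_inj ->|ij]; first by rewrite eqxx mulr1n sconj_inj -rmorphM expr2.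
    by rewrite rmorph0 mulr0 -val_eqE (negbTE ij) mulr0n.
  rewrite rmorph0 mul0rn big1 // => h _; rewrite mxE ifN ?mul0r //.
  by rewrite neq_ltn (leq_trans (ltn_ord h) ni) orbT.
rewrite char_poly_trig ?diag_mx_is_trig // /sv_sqr -map_comp big_map.
rewrite -[iota 0 m]val_enum_ord big_map big_enum /=.
by apply: eq_bigr => i _; rewrite !mxE eqxx mulr1n.
Qed.

(** The characteristic polynomial of A A^* fixes the squares as a multiset, and monotonicity fixes
    their order. *)
Lemma svd_sv_sqr m n (A : 'M[K]_(m, n)) U1 s1 V1 U2 s2 V2 :
  is_svd A U1 s1 V1 -> is_svd A U2 s2 V2 ->
  forall i, (i < m)%N -> (i < n)%N -> s1 i ^+ 2 = s2 i ^+ 2.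
Proof.
move=> A1 A2 i im inn.
have : perm_eq (sv_sqr m n s1) (sv_sqr m n s2).
  have := svd_char_poly A1; rewrite (svd_char_poly A2) => /prod_XsubC_eq.
  by rewrite perm_sym; apply: perm_map_inj; exact: sinj_inj.
have sort_sv U s V : is_svd A U s V -> sorted (fun x y : R => y <= x) (sv_sqr m n s).
  case=> _ _ s0 smono _; apply: (homo_sorted (e := leq)); last first.
    by apply: sub_sorted (iota_ltn_sorted 0 m) => a b; exact: ltnW.
  move=> a b ab; case: ltnP => bn; last by case: ifP => // _; rewrite sqr_ge0.
  by rewrite (leq_ltn_trans ab bn) ler_sqr ?nnegrE // smono.
move=> /(sorted_eq _ _ (sort_sv _ _ _ A1) (sort_sv _ _ _ A2)) E.
have {}E : sv_sqr m n s1 = sv_sqr m n s2.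
  apply: E => [y x z xy yz|x y /andP[xy yx]]; first exact: le_trans yz xy.
  by apply/eqP; rewrite eq_le xy yx.
have := congr1 (fun u => nth 0 u i) E.
by rewrite !(nth_map 0%N) ?size_iota // nth_iota // add0n inn.
Qed.

(** The decomposition picked by [xget] may have other singular vectors, but the error depends only
    on the singular values. *)
Lemma best_approx_error q m n (A : 'M[K]_(m, n)) U s V : is_svd A U s V ->
  frobenius (A - best_approx q A) ^+ 2 =
  \sum_(i < m | (i < n)%N) (if (i < q)%N then 0 else s i ^+ 2).
Proof.
move=> Asvd; rewrite /best_approx; case: xgetP => [B _ [U' [s' [V' [A' ->]]]]|/(_ _) no].
  have -> : \sum_(i < m | (i < n)%N) (if (i < q)%N then 0 else s i ^+ 2) =
      \sum_(i < m | (i < n)%N) ((if (i < q)%N then 0 else s' i) : R) ^+ 2.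
    apply: eq_bigr => i ni; rewrite (svd_sv_sqr Asvd A') //.
    by case: ifP => // _; rewrite expr0n.
  case: A' => U1 V1 _ _ ->; rewrite -mulmxBl -mulmxBr.
  rewrite (frobenius_unitary _ U1 V1).
  rewrite -(frobenius_diag _ _ (fun i => if (i < q)%N then 0 else s' i)).
  congr (frobenius _ ^+ 2); apply/matrixP => i j; rewrite !mxE.
  by case: eqP => _; rewrite ?subr0 //; case: ifP; rewrite ?subrr ?rmorph0 ?subr0.
exfalso; apply: (no (U *m diag_sv k m n (fun i => if (i < q)%N then s i else 0)
          *m V ^t (sconj R k))).
by exists U, s, V.
Qed.

End SVD.

(** * Orthogonal projections and the error of the randomized approximation *)

Section Projection.
Variables (R : realType) (k : scalar_kind).
Local Notation K := (scalar_field R k).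
Local Notation cj := (sconj R k).
Local Notation inj := (sinj R k).

(** Let Q be the transpose of the right side. The rows of Q lie in the row space of F^T and those of
    1 - Q in its orthogonal complement, so [proj_mx] fixes the former and kills the latter. *)
Lemma range_projE m n (F : 'M[K]_(m, n)) : ctr F *m F \in unitmx ->
  range_proj F = F *m invmx (ctr F *m F) *m ctr F.
Proof.
move=> Fu; apply: trmx_inj; rewrite /range_proj trmxK.
set O := orthomx _ _ _; set Q := (_ *m _)^T.
have OE (p : nat) (X : 'M[K]_(p, m)) : X *m map_mx cj F = 0 -> (X <= O)%MS.
  by move=> XF; apply/sub_kermxP; rewrite mul1mx trmxK.
have dx : (<<F^T>> :&: O = 0)%MS.
  apply/eqP/rowV0P => v; rewrite sub_capmx genmxE => /andP[/submxP [w ->]].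
  move=> /sub_kermxP; rewrite mul1mx trmxK -mulmxA => wG.
  suff -> : w = 0 by rewrite mul0mx.
  have Gu : F^T *m map_mx cj F \in unitmx.
    by rewrite -unitmx_tr trmx_mul trmxK map_trmx.
  by rewrite -[w](mulmxK Gu) wG mul0mx.
have QF : (Q <= <<F^T>>)%MS.
  by rewrite genmxE /Q trmx_mul trmx_mul mulmxA submxMl.
have QO : (1%:M - Q <= O)%MS.
  apply: OE; apply: trmx_inj; rewrite trmx_mul trmx0 linearB /= trmx1 /Q trmxK map_trmx.
  rewrite -/(ctr F) mulmxBr mulmx1 !mulmxA.
  by rewrite -!mulmxA (mulmxA (ctr F)) mulmxA mulmxV // mul1mx subrr.
by rewrite -[LHS]mul1mx -(subrK Q 1%:M) mulmxDl proj_mx_0 // add0r proj_mx_id.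
Qed.

(* [A = B Z] with [Z] a co-isometry and [B^* B = (E + d) / d]. *)
Lemma projection_error m n r l q (d : R) (B : 'M[K]_(m, r)) (Z : 'M[K]_(r, n))
    (F : 'M[K]_(m, l)) (M : 'M[K]_(r, l)) :
  (q <= r)%N -> 0 < d -> Z *m ctr Z = 1%:M -> ctr B *m B = inj d^-1 *: wmx k r q d ->
  ctr M *m M \in unitmx -> F = B *m M ->
  frobenius (B *m Z - range_proj F *m (B *m Z)) ^+ 2 =
  (1 + d) * tau q d M + (r - q)%N%:R - l%:R.
Proof.
move=> qr d0 Z1 BB Mu FE.
have dn : inj d^-1 != 0 by rewrite sinj_eq0 invr_eq0 gt_eqF.
have dd : inj d^-1 * inj d = 1 by rewrite -rmorphM mulVf ?rmorph1 // gt_eqF.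
have Wu : wgram q d M \in unitmx by exact: wgram_unit.
have FF : ctr F *m F = inj d^-1 *: wgram q d M.
  by rewrite FE ctrM mulmxA -(mulmxA (ctr M)) BB -scalemxAr -scalemxAl.
have Fu : ctr F *m F \in unitmx by rewrite FF unitmxZ // unitfE.
pose Pi := range_proj F.
have PiE : Pi = inj d *: (F *m invmx (wgram q d M) *m ctr F).
  have iF : invmx (ctr F *m F) = inj d *: invmx (wgram q d M).
    rewrite FF invmxZ; last by rewrite -FF.
    by congr (_ *: _); apply: (mulfI dn); rewrite mulfV // dd.
  by rewrite /Pi range_projE // iF -scalemxAr -scalemxAl.
have PiF : Pi *m F = F.
  by rewrite /Pi range_projE // -!mulmxA mulVmx ?mulmx1.
have PiC : ctr Pi = Pi.
  by rewrite PiE ctrZ sconj_inj !ctrM ctrK ctr_invmx ctr_wgram mulmxA.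
have Pi2 : Pi *m Pi = Pi by rewrite {2}PiE -scalemxAr 2!mulmxA PiF -PiE.
apply: (@sinj_inj R k); rewrite frob_trace -/Pi.
have -> : B *m Z - Pi *m (B *m Z) = (1%:M - Pi) *m B *m Z.
  by rewrite mulmxBl mul1mx mulmxBl mulmxA.
have -> : (1%:M - Pi) *m B *m Z *m ctr ((1%:M - Pi) *m B *m Z) =
    (1%:M - Pi) *m (B *m ctr B) *m (1%:M - Pi).
  rewrite !ctrM ctrB ctr1 PiC -!mulmxA (mulmxA Z) Z1 mul1mx //.
rewrite mxtrace_mulC (mulmxA (1%:M - Pi) (1%:M - Pi)).
have -> : (1%:M - Pi) *m (1%:M - Pi) = 1%:M - Pi.
  by rewrite mulmxBl mul1mx mulmxBr mulmx1 Pi2 subrr subr0.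
rewrite mulmxBl mul1mx linearB /= [\tr (B *m _)]mxtrace_mulC BB.
rewrite mulmxA [\tr (_ *m ctr B)]mxtrace_mulC mulmxA.
have BF : ctr B *m F = inj d^-1 *: (wmx k r q d *m M).
  by rewrite FE mulmxA BB -scalemxAl.
have FB : ctr F *m B = inj d^-1 *: (ctr M *m wmx k r q d).
  by rewrite -[LHS]ctrK ctrM ctrK BF ctrZ sconj_inj ctrM ctr_diag.
have -> : ctr B *m Pi *m B = inj d^-1 *: (wmx k r q d *m wproj q d M *m wmx k r q d).
  transitivity (inj d *: ((ctr B *m F) *m invmx (wgram q d M) *m (ctr F *m B))).
    by rewrite PiE -scalemxAr -scalemxAl !mulmxA.
  rewrite BF FB -scalemxAr -!scalemxAl !scalerA; congr (_ *: _).
    by rewrite mulrA [inj d * _]mulrC dd mul1r.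
  by rewrite /wproj !mulmxA.
have trE : \tr (wmx k r q d - wmx k r q d *m wproj q d M *m wmx k r q d) =
    inj (\sum_i (wt q d i - wt q d i ^+ 2 * dg q d M i)).
  rewrite /mxtrace raddf_sum; apply: eq_bigr => i _.
  have ent (X : 'M[K]_r) : (wmx k r q d - wmx k r q d *m X *m wmx k r q d) i i =
      inj (wt q d i) - inj (wt q d i) * X i i * inj (wt q d i).
    by rewrite mul_mx_diag mul_diag_mx !mxE eqxx mulr1n.
  by rewrite ent (dgE q d0 Mu) /= [in RHS]rmorphB rmorphM rmorphXn expr2 mulrAC.
have trB (X Y : 'M[K]_r) : \tr X - \tr Y = \tr (X - Y) by rewrite linearB.
rewrite !mxtraceZ -mulrBr trB trE -rmorphM; congr (inj _).
(* The sum of the diagonal entries of index at least q is eliminated through this identity; it is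
   the source of the term - l. *)
have := trace_split q Mu d0.
have -> : \sum_i (wt q d i - wt q d i ^+ 2 * dg q d M i) =
    q%:R * (1 + d) + (r - q)%N%:R * d - (1 + d) ^+ 2 * toptr q d M
    - d ^+ 2 * (\sum_(j < r | ~~ (j < q)%N) dg q d M j).
  rewrite (bigID (fun i : 'I_r => (i < q)%N)) /= !sumrB.
  have -> : \sum_(i < r | (i < q)%N) wt q d i = q%:R * (1 + d).
    by rewrite (natr_top R qr) mulr_suml; apply: eq_bigr => i iq; rewrite wtT // mul1r.
  have -> : \sum_(i < r | (i < q)%N) wt q d i ^+ 2 * dg q d M i = (1 + d) ^+ 2 * toptr q d M.
    by rewrite mulr_sumr; apply: eq_bigr => i iq; rewrite wtT.
  have -> : \sum_(i < r | ~~ (i < q)%N) wt q d i = (r - q)%N%:R * d.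
    by rewrite (natr_bot R qr) mulr_suml; apply: eq_bigr => i iq; rewrite wtF // mul1r.
  have -> : \sum_(i < r | ~~ (i < q)%N) wt q d i ^+ 2 * dg q d M i =
      d ^+ 2 * (\sum_(j < r | ~~ (j < q)%N) dg q d M j).
    by rewrite mulr_sumr; apply: eq_bigr => i iq; rewrite wtF.
  ring.
rewrite /tau; move: (toptr q d M) (\sum_(j < r | _) _) => a g <-.
by field; rewrite gt_eqF.
Qed.

End Projection.

(** * The hard instance *)

Section HardInstance.
Variables (R : realType) (k : scalar_kind).
Local Notation K := (scalar_field R k).
Local Notation inj := (sinj R k).

Lemma ctr_pid m n r : ctr (pid_mx r : 'M[K]_(m, n)) = pid_mx r.
Proof. by rewrite /ctr tr_pid_mx map_pid_mx. Qed.

(** The factor B consists of the r columns of D that carry the nonzero singular values. Through it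
    the error for A depends on the test matrix only via the r x l matrix M, for every l. *)
Lemma hard_instance m n r q (d : R) (V : 'M[K]_n) (Q : 'M[K]_r) :
  (q <= r)%N -> (r <= m)%N -> (r <= n)%N -> 0 < d ->
  ctr V *m V = 1%:M -> ctr Q *m Q = 1%:M ->
  exists A : 'M[K]_(m, n), [/\ \rank A = r,
    frobenius (A - best_approx q A) ^+ 2 = (r - q)%N%:R &
    exists B : 'M[K]_(m, r),
    (forall l (Omega : 'M[K]_(n, l)), A *m Omega = B *m (Q *m (pid_mx r *m V *m Omega))) /\
    forall l (M : 'M[K]_(r, l)), ctr M *m M \in unitmx ->
      frobenius (A - range_proj (B *m M) *m A) ^+ 2 =
      (1 + d) * tau q d M + (r - q)%N%:R - l%:R].
Proof.
move=> qr rm rn d0 V1 Q1.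
(* With this choice the squared singular values are the entries of E + d divided by d, and they
   vanish from index r on. *)
pose s (i : nat) : R := if (i < q)%N then Num.sqrt (1 + d^-1) else (i < r)%N%:R.
have dV : 0 < d^-1 by rewrite invr_gt0.
have s2 i : (i < r)%N -> s i ^+ 2 = d^-1 * ((i < q)%N%:R + d).
  move=> ir; rewrite /s ir; case: (i < q)%N => /=.
    by rewrite sqr_sqrtr ?addr_ge0 ?(ltW dV) // mulrDr mulr1 mulVf ?gt_eqF // addrC.
  by rewrite expr1n add0r mulVf // gt_eqF.
have s0 i : 0 <= s i by rewrite /s; case: ifP => _; rewrite ?sqrtr_ge0.
have t1 : 1 <= Num.sqrt (1 + d^-1).
  by rewrite -[leLHS]sqrtr1 ler_wsqrtr // lerDl ltW.
have s_mono i j : (i <= j)%N -> s j <= s i.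
  move=> ij; rewrite /s; case: (ltnP j q) => [jq|qj]; first by rewrite (leq_ltn_trans ij jq).
  case: (ltnP i q) => [iq|qi].
    by apply: le_trans _ t1; rewrite -[leRHS]/(1%:R) ler_nat leq_b1.
  by rewrite ler_nat; case: (ltnP j r) => [jr|//]; rewrite (leq_ltn_trans ij jr).
pose Z : 'M[K]_(r, n) := pid_mx r.
have ZZ : Z *m ctr Z = 1%:M by rewrite ctr_pid pid_mx_id // pid_mx_1.
pose C : 'M[K]_n := 1%:M - ctr Z *m Z.
have ZC : Z *m C = 0 by rewrite mulmxBr mulmx1 mulmxA ZZ mul1mx subrr.
have CZ : C *m ctr Z = 0 by rewrite mulmxBl mul1mx -mulmxA ZZ mulmx1 subrr.
have cC : ctr C = C by rewrite ctrB ctr1 ctrM ctrK.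
have CC : C *m C = C by rewrite {1}/C mulmxBl mul1mx -mulmxA ZC mulmx0 subr0.
have CE : ctr Z *m Z + C = 1%:M by rewrite addrC subrK.
(* Q is extended by the identity on the remaining n - r coordinates. *)
clearbody C; pose Qt := ctr Z *m Q *m Z + C.
have Qt1 : ctr Qt *m Qt = 1%:M.
  rewrite /Qt ctrD cC !ctrM ctrK mulmxDl !mulmxDr CC.
  rewrite !mulmxA CZ !mul0mx add0r -(mulmxA _ Z C) ZC mulmx0 addr0.
  rewrite -(mulmxA _ Z (ctr Z)) ZZ mulmx1 -(mulmxA _ (ctr Q)) Q1 mulmx1.
  exact: CE.
have ZQt : Z *m Qt = Q *m Z by rewrite /Qt mulmxDr ZC addr0 !mulmxA ZZ mul1mx.
pose U := Qt *m V.
have ZQt' : Z *m U = Q *m Z *m V by rewrite mulmxA ZQt.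
have U1 : ctr U *m U = 1%:M by rewrite ctrM mulmxA -(mulmxA (ctr V)) Qt1 mulmx1.
have U2 : U *m ctr U = 1%:M by exact: mulmx1C.
pose B := diag_sv k m r s; pose A := diag_sv k m n s *m U.
have DB : diag_sv k m n s = B *m Z.
  apply/matrixP => i h; rewrite [LHS]mxE [RHS]mxE.
  case: (ltnP h r) => [hr|rh].
    rewrite (bigD1 (Ordinal hr)) //= big1 => [|j jh]; last first.
      by rewrite [Z _ _]mxE (negbTE (_ : (j : nat) != h)) ?mulr0 //; move: jh; rewrite -val_eqE.
    by rewrite addr0 !mxE /= eqxx hr mulr1.
  rewrite big1 => [|j _].
    case: eqP => // ih; rewrite /s ltnNge (leq_trans qr) ?ih //= ltnNge rh //=.
    by rewrite rmorph0.
  by rewrite [Z _ _]mxE ltn_eqF ?mulr0 // (leq_trans (ltn_ord j)).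
have AE : A = B *m (Z *m U) by rewrite /A DB mulmxA.
have ZU : Z *m U *m ctr (Z *m U) = 1%:M.
  by rewrite ctrM mulmxA -(mulmxA Z) U2 mulmx1.
have BB : ctr B *m B = inj d^-1 *: wmx k r q d.
  apply/matrixP => i j; rewrite [LHS]mxE.
  have im : (i < m)%N by exact: leq_trans rm.
  rewrite (bigD1 (Ordinal im)) //= big1 => [|h hi]; last first.
    by rewrite ctrE mxE ifN ?rmorph0 ?mul0r //; move: hi; rewrite -val_eqE.
  rewrite addr0 ctrE !mxE /= eqxx sconj_inj /wt.
  rewrite -[(i : nat) == j]/(val i == val j) val_eqE.
  case: eqVneq => [ij|_]; last by rewrite mulr0 mulr0n mulr0.
  by rewrite -?ij mulr1n -!rmorphM -expr2 s2.
exists A; split.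
- have rB : \rank B = r.
    apply/eqP; rewrite -gram_unit BB unitmxZ ?unitfE ?sinj_eq0 ?gt_eqF // unitmxE det_diag.
    rewrite unitfE prodf_seq_neq0; apply/allP => i _ /=.
    by rewrite mxE sinj_eq0 gt_eqF // wt_gt0.
  apply/eqP; rewrite eqn_leq; apply/andP; split.
    by rewrite AE (leq_trans (mxrankM_maxl _ _)) // rank_leq_col.
  have -> : r = \rank (A *m ctr (Z *m U)) by rewrite AE -mulmxA ZU mulmx1 rB.
  exact: mxrankM_maxl.
- have Asvd : is_svd A 1%:M s (ctr U).
    split => //; rewrite /unitary.
    + by rewrite trmx1 map_mx1 mulmx1.
    + by rewrite -/(ctr (ctr U)) ctrK.
    + by rewrite mul1mx -/(ctr (ctr U)) ctrK.
  rewrite (best_approx_error q Asvd) (natr_bot R qr).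
  rewrite [RHS]big_mkcond (big_ord_widen m (fun i => if ~~ (i < q)%N then 1 else 0) rm).
  rewrite big_mkcond [RHS]big_mkcond; apply: eq_bigr => i _.
  case: (ltnP i r) => ir.
    rewrite (leq_trans ir rn); case: ifP => iq //=.
    by rewrite s2 // iq add0r mulVf // gt_eqF.
  case: ifP => // _; rewrite ltnNge (leq_trans qr ir) /=.
  by rewrite /s ltnNge (leq_trans qr ir) /= ltnNge ir expr0n.
exists B; split=> [l Omega|l M Mu].
  by rewrite AE ZQt' !mulmxA.
by rewrite AE; apply: (projection_error qr d0 ZU BB Mu).
Qed.

End HardInstance.

(** * Passing from bounded minorants to the expectation *)

Section Expectation.
Variables (R : realType) (disp : measure_display) (T : measurableType disp).
Variable P : probability T R.

(** Only g comes with measurability, so the comparison takes place in the suprema over simple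
    functions that define the two integrals: a nonnegative simple function below g on D and below 0
    elsewhere is below f. *)
Lemma mean_le_expectation (D : set T) (f g : T -> R) :
  measurable D -> P (~` D) = 0%E -> bmeas g -> (forall t, 0 <= g t) ->
  (forall t, 0 <= f t) -> (forall t, D t -> g t <= f t) ->
  ((mean P g)%:E <= 'E_P[f])%E.
Proof.
move=> mD PD bg g0 f0 gf.
have -> : (mean P g)%:E = (\int[P]_t (g t)%:E)%E.
  by rewrite /mean /Rintegral fineK //; apply: integrable_fin_num => //; exact: bmeas_integrable.
have mg : measurable_fun setT (EFin \o g) by apply/measurable_EFinP; case: bg.
have -> : (\int[P]_t (g t)%:E = \int[P]_(t in D) (g t)%:E)%E.
  rewrite -(setUv D) ge0_integral_setU //=.
  - rewrite [X in (_ + X)%E](_ : _ = 0%E) ?adde0 //; apply: null_set_integral => //.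
      exact: measurableC.
    exact: measurable_funTS.
  - exact: measurableC.
  - by rewrite setUv.
  - by move=> t _; rewrite lee_fin.
  - by apply/disj_set2P; rewrite setICr.
rewrite unlock ge0_integralE => [|t _]; last by rewrite lee_fin.
rewrite [leRHS]ge0_integralE => [|t _]; last by rewrite lee_fin.
apply: ereal_sup_le => _ [h hg <-]; exists h => //= t.
apply: (le_trans (hg t)); rewrite /patch in_setT; case: ifPn => [/set_mem Dt|_].
  by rewrite lee_fin; exact: gf.
by rewrite lee_fin.
Qed.

End Expectation.

Section Reduction.
Variables (R : realType) (k : scalar_kind).
Local Notation K := (scalar_field R k).
Local Notation al := ((alpha k)%:R : R).
Variables (disp : measure_display) (T : measurableType disp) (P : probability T R).

Lemma smeas_if (D : set T) (X : T -> K) (c : K) : measurable D ->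
  smeasurable_fun X -> smeasurable_fun (fun t => if t \in D then X t else c).
Proof.
move=> mD mX.
rewrite (_ : (fun t => _) = (fun t => X t * sinj R k (\1_D t) + c * sinj R k (\1_(~` D) t))).
  apply: smeasD; apply: smeasM => //; [|exact: smeas_cst|]; apply: smeas_inj.
    exact: measurable_indic.
  by apply: measurable_indic; exact: measurableC.
apply/funext => t; rewrite !indicE in_setC; case: (t \in D) => /=.
  by rewrite rmorph1 rmorph0 mulr1 mulr0 addr0.
by rewrite rmorph1 rmorph0 mulr1 mulr0 add0r.
Qed.

End Reduction.

Theorem theorem3p3 (R : realType) (k : scalar_kind)
    (disp : measure_display) (T : measurableType disp) (P : probability T R)
    (n l : nat) (Omega : T -> 'M[scalar_field R k]_(n, l))
    (hOmega : full_rank_random_embedding P Omega)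
    (d q r : nat)
    (hql : (q + alpha k < l)%N) (hlr : (l <= r)%N) (hr : (r <= minn d n)%N) :
  (((r%:R - l%:R) / (r%:R - q%:R) *
     (1 + q%:R / (l%:R - q%:R - (alpha k)%:R)))%:E <=
   ereal_sup
     [set ('E_P[fun t => (frobenius (A - range_proj (A *m Omega t) *m A) ^+ 2)%R]
            / (frobenius (A - best_approx q A) ^+ 2)%R%:E)
     | A in [set A : 'M[scalar_field R k]_(d, n) | \rank A = r]])%E.
Proof.
case: hOmega => _ mOm aeOm.
move: hr; rewrite leq_min => /andP[rd rn].
have l0 : (0 < l)%N by exact: leq_ltn_trans hql.
have ql : (q < l)%N by exact: leq_ltn_trans (leq_addr _ _) hql.
have qr : (q < r)%N by exact: leq_trans hlr.
have lr : (0 < l <= r)%N by rewrite l0.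
have [V V1 aeV] := ae_full_rank_unitary lr rn mOm aeOm.
pose M0 t : 'M[scalar_field R k]_(r, l) := pid_mx r *m V *m Omega t.
have mM0 : random_matrix M0 by apply: rmxM => //; exact: rmx_cst.
pose D := [set t | ctr (M0 t) *m M0 t \in unitmx].
have mD : measurable D by exact: measurable_gram_unit.
have PD : P (~` D) = 0%E.
  apply/negligibleP; first exact: measurableC.
  apply: negligibleS aeV => t /= nD rl; apply: nD; rewrite /D /= gram_unit eqn_leq rank_leq_col /=.
  have lE : (pid_mx r : 'M[scalar_field R k]_(n, r)) *m M0 t = pid_mx r *m V *m Omega t.
    by rewrite /M0 !mulmxA pid_mx_id.
  by rewrite -[leqLHS]rl -lE mxrankM_maxr.
(* On the null set where the rank drops, a fixed matrix of full rank is substituted, so that the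
   Gram matrix is invertible at every point. *)
pose M t := if t \in D then M0 t else pid_mx l.
have mM : random_matrix M.
  move=> i j; rewrite (_ : (fun t => _) = (fun t => if t \in D then M0 t i j else pid_mx l i j)).
    exact: smeas_if.
  by apply/funext => t; rewrite /M; case: ifP.
have Mf t : ctr (M t) *m M t \in unitmx.
  rewrite /M; case: ifPn => [/set_mem //|_].
  by rewrite ctr_pid pid_mx_id // pid_mx_1 unitmx1.
set E := [set _ | _ in _].
pose p : R := (r - q)%N%:R.
have pE : p = r%:R - q%:R by rewrite /p natrB // ltnW.
have p0 : 0 < p by rewrite ltr0n subn_gt0.
have gu (Q : 'M[scalar_field R k]_r) t : ctr Q *m Q = 1%:M ->
    ctr (Q *m M t) *m (Q *m M t) \in unitmx.
  by move=> Q1; rewrite gram_unitary.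
have key (Q : 'M[scalar_field R k]_r) (e : R) : ctr Q *m Q = 1%:M -> 0 < e ->
    ((((1 + e) * mean P (fun t => tau q e (Q *m M t)) + (p - l%:R)) / p)%:E <= ereal_sup E)%E.
  move=> Q1 e0; have [A [rA eA [B [AO AB]]]] := hard_instance (ltnW qr) rd rn e0 V1 Q1.
  pose f t := frobenius (A - range_proj (A *m Omega t) *m A) ^+ 2.
  have EA : E ('E_P[f] / (frobenius (A - best_approx q A) ^+ 2)%:E)%E by exists A.
  apply: le_trans (ereal_sup_ubound EA).
  pose g t := (1 + e) * tau q e (Q *m M t) + (p - l%:R).
  have gE t : g t = frobenius (A - range_proj (B *m (Q *m M t)) *m A) ^+ 2.
    by rewrite AB ?gu // /g addrA.
  have bt := bmeas_tau (ltnW qr) mM Mf Q1 e0.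
  have -> : (1 + e) * mean P (fun t => tau q e (Q *m M t)) + (p - l%:R) = mean P g.
    apply/esym; apply: (etrans (meanD P (bmeasZ (1 + e) bt) (bmeas_cst T (p - l%:R)))).
    by rewrite mean_cst meanZ.
  rewrite eA inver -/p gt_eqF // lee_pdivlMr // -EFinM divfK ?gt_eqF //.
  apply: (mean_le_expectation mD PD) => [|t|t|t Dt].
  - by apply: bmeasD; [exact: bmeasZ|exact: bmeas_cst].
  - by rewrite gE sqr_ge0.
  - exact: sqr_ge0.
  - by rewrite gE /f AO /M mem_set.
have Q1 : ctr (1%:M : 'M[scalar_field R k]_r) *m 1%:M = 1%:M by rewrite ctr1 mulmx1.
have tau0 (Q : 'M[scalar_field R k]_r) (e : R) : ctr Q *m Q = 1%:M -> 0 < e ->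
    0 <= mean P (fun t => tau q e (Q *m M t)).
  exact: (mean_tau_ge0 P (ltnW qr) mM Mf).
(* An infinite supremum makes the claim trivial, and [key] at the identity excludes minus
   infinity. *)
case: (ereal_sup E) key => [S|_|/(_ _ _ Q1 ltr01)]; first last.
- by rewrite leeNy_eq.
- by rewrite leey.
move=> key; have {}key (Q : 'M[scalar_field R k]_r) (e : R) : ctr Q *m Q = 1%:M -> 0 < e ->
    (1 + e) * mean P (fun t => tau q e (Q *m M t)) + (p - l%:R) <= S * p.
  by move=> Qu e0; have := key Q e Qu e0; rewrite lee_fin ler_pdivrMr.
(* [key] solved for (1 + e) times the mean of [tau]; the nonnegative part with factor e is then
   dropped. *)
pose S' := S * p - (p - l%:R).
have tauS (Q : 'M[scalar_field R k]_r) (e : R) : ctr Q *m Q = 1%:M -> 0 < e -> e <= 1 ->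
    mean P (fun t => tau q e (Q *m M t)) <= S'.
  move=> Qu e0 _; have := key Q e Qu e0; have := tau0 Q e Qu e0.
  rewrite /S'; move: (mean _ _) => x x0; have := mulr_ge0 (ltW e0) x0; lra.
have := mean_tau_bound (ltnW qr) (ltnW hql) mM Mf tauS.
rewrite -/p -pE lee_fin => main.
have c0 : 0 < l%:R - q%:R - (alpha k)%:R :> R.
  by rewrite -addrA -opprD -natrD subr_gt0 ltr_nat.
(* This rests on (r - q - l) (l - q - alpha) + (r - q - alpha) q = (r - l) (l - alpha). *)
rewrite [leLHS](_ : _ = (p - l%:R + (p - (alpha k)%:R) * q%:R / (l%:R - q%:R - (alpha k)%:R)) / p).
  rewrite ler_pdivrMr // -lerBrDl ler_pdivrMr // [leRHS]mulrC; exact: main.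
have cn := gt_eqF c0; rewrite pE in p0 *; have pn := gt_eqF p0.
by field; rewrite cn pn.
Qed.
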